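(* Let $(\mathcal C,\otimes)$ be a $K$-linear Gray semigroup. Then the equivalence classes of first order unitary deformations of $(\mathcal C,\otimes)$ are in bijection with the elements of $H^2_{unit}(\mathcal C)$, the second cohomology group of the unitary deformation complex $X^\bullet_{unit}(\mathcal C)$.
   Context: Conventions. $K$ is a commutative ring with unit. In a (strict) 2-category, $id_X$ is the identity 1-morphism, $1_f$ the identity 2-morphism, $\sigma\cdot\tau$ the vertical composite (first $\tau$), and $\circ$ denotes composition of 1-morphisms ($g\circ f$: first $f$) and horizontal composition of 2-morphisms. A 2-category is $K$-linear if its sets of 2-morphisms are $K$-modules and vertical and horizontal composition are $K$-bilinear. Gray semigroup. A Gray semigroup $(\mathcal C,\otimes)$ is a 2-category $\mathcal C$ with objects $X\otimes Y$, functors $\mathcal C(X,X')\times\mathcal C(Y,Y')\to\mathcal C(X\otimes Y,X'\otimes Y')$ written $(f,g)\mapsto f\otimes g$, $(\tau,\sigma)\mapsto\tau\otimes\sigma$, and 2-isomorphisms $\widehat\otimes((f',g'),(f,g)):(f'\otimes g')\circ(f\otimes g)\Rightarrow(f'\circ f)\otimes(g'\circ g)$, natural in all arguments, such that: $id_X\otimes id_Y=id_{X\otimes Y}$; $\widehat\otimes((f'',g''),(f'\circ f,g'\circ g))\cdot(1_{f''\otimes g''}\circ\widehat\otimes((f',g'),(f,g)))=\widehat\otimes((f''\circ f',g''\circ g'),(f,g))\cdot(\widehat\otimes((f'',g''),(f',g'))\circ1_{f\otimes g})$; $\widehat\otimes((id,id),(f,g))$ and $\widehat\otimes((f,g),(id,id))$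 are identities; (cubical) all $\widehat\otimes((f',id),(f,g))$ and $\widehat\otimes((f,g'),(id,g))$ are identities; $\otimes$ is strictly associative on objects, 1-morphisms and 2-morphisms; and $(\widehat\otimes((f',g'),(f,g))\otimes1_{h'\circ h})\cdot\widehat\otimes((f'\otimes g',h'),(f\otimes g,h))=(1_{f'\circ f}\otimes\widehat\otimes((g',h'),(g,h)))\cdot\widehat\otimes((f',g'\otimes h'),(f,g\otimes h))$. It is $K$-linear if $\mathcal C$ is $K$-linear and $(\tau,\sigma)\mapsto\tau\otimes\sigma$ is $K$-bilinear. First order unitary deformations. Let $\mathcal C_\epsilon$ have the same objects and 1-morphisms as $\mathcal C$, with 2-morphisms $\tau_0+\tau_1\epsilon$ ($\tau_0,\tau_1$ parallel 2-morphisms of $\mathcal C$, $\epsilon^2=0$); vertical and horizontal compositions and $\otimes$ of 2-morphisms are extended $K[\epsilon]/(\epsilon^2)$-bilinearly. A first order unitary deformation consists of families $\widehat\otimes_\epsilon((f',g'),(f,g))=\widehat\otimes((f',g'),(f,g))+\widehat\otimes^{(1)}((f',g'),(f,g))\epsilon$, $\widehat a_\epsilon(f,g,h)=1_{f\otimes g\otimes h}+\widehat a^{(1)}(f,g,h)\epsilon$, $(\pi_\epsilon)_{X,Y,Z,T}=1_{id_{X\otimes Y\otimes Z\otimes T}}+(\pi^{(1)})_{X,Y,Z,T}\epsilon$ of 2-isomorphisms of $\mathcal C_\epsilon$ (the objects $X\otimes Y$, the functors $\otimes$, the identities $id_X\otimes id_Y=id_{X\otimes Y}$ and the identity associator 1-morphisms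 being unchanged) that define a semigroupal structure on $\mathcal C_\epsilon$, i.e. (dropping arguments that are clear) (1) $\widehat\otimes_\epsilon$ is natural, satisfies the same cocycle identity as $\widehat\otimes$ above, and $\widehat\otimes_\epsilon((id,id),(f,g))$, $\widehat\otimes_\epsilon((f,g),(id,id))$ are identities; (2) $\widehat a_\epsilon$ is natural, $\widehat a_\epsilon(id_X,id_Y,id_Z)$ is the identity, and $\widehat a_\epsilon(f'f,g'g,h'h)\cdot(\widehat\otimes_\epsilon((f',g'),(f,g))\otimes1_{h'h})\cdot\widehat\otimes_\epsilon((f'\otimes g',h'),(f\otimes g,h))=(1_{f'f}\otimes\widehat\otimes_\epsilon((g',h'),(g,h)))\cdot\widehat\otimes_\epsilon((f',g'\otimes h'),(f,g\otimes h))\cdot(\widehat a_\epsilon(f',g',h')\circ1_{f\otimes g\otimes h})\cdot(1_{f'\otimes g'\otimes h'}\circ\widehat a_\epsilon(f,g,h))$; (3) $\widehat a_\epsilon(f,g,h\otimes k)\cdot\widehat a_\epsilon(f\otimes g,h,k)\cdot(1_{f\otimes g\otimes h\otimes k}\circ(\pi_\epsilon)_{X,Y,Z,T})=((\pi_\epsilon)_{X',Y',Z',T'}\circ1_{f\otimes g\otimes h\otimes k})\cdot(1_f\otimes\widehat a_\epsilon(g,h,k))\cdot\widehat a_\epsilon(f,g\otimes h,k)\cdot(\widehat a_\epsilon(f,g,h)\otimes1_k)$ for $(f,g,h,k):(X,Y,Z,T)\to(X',Y',Z',T')$; (4) $\pi_{X\otimes Y,Z,T,U}\cdot\pi_{X,Y,Z\otimes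 T,U}\cdot(\pi_{X,Y,Z,T}\otimes1_{id_U})=\pi_{X,Y,Z,T\otimes U}\cdot\pi_{X,Y\otimes Z,T,U}\cdot(1_{id_X}\otimes\pi_{Y,Z,T,U})$ with $\pi=\pi_\epsilon$. Equivalence. Two such deformations $(\widehat\otimes_\epsilon,\widehat a_\epsilon,\pi_\epsilon)$ and $(\widehat\otimes'_\epsilon,\widehat a'_\epsilon,\pi'_\epsilon)$ are equivalent if the identity 2-functor of $\mathcal C_\epsilon$ admits a semigroupal structure $(\psi,\omega)$ with $\psi_{X,Y}=id_{X\otimes Y}$ and with $\widehat\psi(f,g)$ and $\omega_{X,Y,Z}$ identities mod $\epsilon$; explicitly, there are 2-isomorphisms $\widehat\psi(f,g)=1_{f\otimes g}+\widehat\psi^{(1)}(f,g)\epsilon$ and $\omega_{X,Y,Z}=1_{id_{X\otimes Y\otimes Z}}+(\omega^{(1)})_{X,Y,Z}\epsilon$ such that $\widehat\psi$ is natural in $(f,g)$; $\widehat\psi(id,id)=1$; $\widehat\psi(f'f,g'g)\cdot\widehat\otimes_\epsilon((f',g'),(f,g))=\widehat\otimes'_\epsilon((f',g'),(f,g))\cdot(\widehat\psi(f',g')\circ1_{f\otimes g})\cdot(1_{f'\otimes g'}\circ\widehat\psi(f,g))$; $(\omega_{X',Y',Z'}\circ1_{f\otimes g\otimes h})\cdot(1_f\otimes\widehat\psi(g,h))\cdot\widehat\psi(f,g\otimes h)\cdot\widehat a_\epsilon(f,g,h)=\widehat a'_\epsilon(f,g,h)\cdot(\widehat\psi(f,g)\otimes1_h)\cdot\widehat\psi(f\otimes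 g,h)\cdot(1_{f\otimes g\otimes h}\circ\omega_{X,Y,Z})$; and $\omega_{X\otimes Y,Z,T}\cdot\omega_{X,Y,Z\otimes T}\cdot(\pi_\epsilon)_{X,Y,Z,T}=(\pi'_\epsilon)_{X,Y,Z,T}\cdot(\omega_{X,Y,Z}\otimes1_{id_T})\cdot\omega_{X,Y\otimes Z,T}\cdot(1_{id_X}\otimes\omega_{Y,Z,T})$. Double complex. For $m,n\ge1$ let $X^{m-1,n-1}(\mathcal C)$ be the $K$-module of families $\phi$ of 2-morphisms $\phi(f_0,\dots,f_{m-1}):T_0\circ\cdots\circ T_{m-1}\Rightarrow c^1\otimes\cdots\otimes c^n$, one for each sequence of composable $n$-tuples $f_j=(f_j^1,\dots,f_j^n)$ of 1-morphisms ($f_{m-1}$ applied first), where $T_j=f_j^1\otimes\cdots\otimes f_j^n$ and $c^k=f_0^k\circ\cdots\circ f_{m-1}^k$, natural with respect to 2-morphisms in all $f_j^k$. Composites $f_{j-1}\circ f_j$ are componentwise. For pairs $p_j=(f_j,g_j)$ put $\Theta_2(p_0)=1$, $\Theta_2(p_0,\dots,p_{m-1})=\widehat\otimes(p_0,p_1\circ\cdots\circ p_{m-1})\cdot(1_{f_0\otimes g_0}\circ\Theta_2(p_1,\dots,p_{m-1}))$. Put $\Theta_1=1$ and $\Theta_n((f_j^1,\dots,f_j^n)_j)=(1_{c^1}\otimes\Theta_{n-1}((f_j^2,\dots,f_j^n)_j))\cdot\Theta_2((f_j^1,f_j^2\otimes\cdots\otimes f_j^n)_j)$ for $n\geq 3$.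 Define $\delta_h:X^{m-1,n-1}(\mathcal C)\to X^{m,n-1}(\mathcal C)$ by $$(\delta_h\phi)(f_0,\dots,f_m)=\Theta_n(f_0,f_1\circ\cdots\circ f_m)\cdot(1_{T_0}\circ\phi(f_1,\dots,f_m))+\sum_{i=1}^m(-1)^i\phi(\dots,f_{i-1}\circ f_i,\dots)\cdot(1\circ\Theta_n(f_{i-1},f_i)\circ1)+(-1)^{m+1}\Theta_n(f_0\circ\cdots\circ f_{m-1},f_m)\cdot(\phi(f_0,\dots,f_{m-1})\circ1_{T_m}),$$ where the outer $1$'s are identities of the remaining $T_j$'s. Define $\delta_v:X^{m-1,n-1}(\mathcal C)\to X^{m-1,n}(\mathcal C)$, for $f_j=(f_j^0,\dots,f_j^n)$, by $$(\delta_v\phi)(f_0,\dots,f_{m-1})=(1_{c^0}\otimes\phi((f_j^1,\dots,f_j^n)_j))\cdot\Theta_2((f_j^0,f_j^1\otimes\cdots\otimes f_j^n)_j)+\sum_{i=1}^n(-1)^i(1\otimes\Theta_2((f_j^{i-1},f_j^i)_j)\otimes1)\cdot\phi((f_j^0,\dots,f_j^{i-1}\otimes f_j^i,\dots,f_j^n)_j)+(-1)^{n+1}(\phi((f_j^0,\dots,f_j^{n-1})_j)\otimes1_{c^n})\cdot\Theta_2((f_j^0\otimes\cdots\otimes f_j^{n-1},f_j^n)_j),$$ where the outer $1$'s are identities of the remaining $c^k$'s. $\phi\in X^{m-1,n-1}(\mathcal C)$ is special if $\phi(f_0,\dots,f_{m-1})=0$ whenever some $f_i=(id,\dots,id)$;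 the special elements form $X_s^{m-1,n-1}(\mathcal C)$, which is preserved by $\delta_h,\delta_v$. Pentagonator part. For $n\ge1$, $\widetilde X^{n-1}_{pent}(\mathcal C)$ is the $K$-module of all families (no naturality required) of 2-morphisms $\mathfrak n_{X_1,\dots,X_n}:id_{X_1\otimes\cdots\otimes X_n}\Rightarrow id_{X_1\otimes\cdots\otimes X_n}$, with $(\delta_{pent}\mathfrak n)_{X_0,\dots,X_n}=1_{id_{X_0}}\otimes\mathfrak n_{X_1,\dots,X_n}+\sum_{i=1}^n(-1)^i\mathfrak n_{X_0,\dots,X_{i-1}\otimes X_i,\dots,X_n}+(-1)^{n+1}\mathfrak n_{X_0,\dots,X_{n-1}}\otimes1_{id_{X_n}}$. Define $\varphi:\widetilde X^{n-1}_{pent}(\mathcal C)\to X^{0,n-1}(\mathcal C)$ by $(\varphi(\mathfrak n))(f_1,\dots,f_n)=\mathfrak n_{X_1',\dots,X_n'}\circ1_{f_1\otimes\cdots\otimes f_n}-1_{f_1\otimes\cdots\otimes f_n}\circ\mathfrak n_{X_1,\dots,X_n}$ for $f_i:X_i\to X_i'$. Unitary deformation complex. For $n\ge1$ put $X^{0,n}_{mod,s}(\mathcal C)=X^{0,n}_s(\mathcal C)\oplus\widetilde X^{n+1}_{pent}(\mathcal C)$ and $X^{m,n}_{mod,s}(\mathcal C)=X^{m,n}_s(\mathcal C)$ for $m\ge1$. On $X^{0,n}_{mod,s}$ let $\delta'_v(\phi,\mathfrak n)=(\delta_v\phi+\varphi(\mathfrak n),-\delta_{pent}\mathfrak n)$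 and $\delta'_h(\phi,\mathfrak n)=\delta_h\phi$; for $m\ge1$ let $\delta'_v=\delta_v$, $\delta'_h=\delta_h$. Then $X^q_{unit}(\mathcal C)=\bigoplus_{m+n=q,\,m\ge0,\,n\ge1}X^{m,n}_{mod,s}(\mathcal C)$ for $q\ge1$, with $\delta_{unit}=\bigoplus((-1)^n\delta'_h+\delta'_v)$; $H^\bullet_{unit}(\mathcal C)$ denotes its cohomology. *)

(* Defs.v *)
From HB Require Import structures.
From mathcomp Require Import all_boot all_algebra.
From mathcomp Require Import boolp.

Set Implicit Arguments.
Unset Strict Implicit.
Unset Printing Implicit Defensive.

Import GRing.Theory.
Local Open Scope ring_scope.

Declare Scope gray_scope.
Delimit Scope gray_scope with gray.
Local Open Scope gray_scope.

Reserved Notation "g ∘₁ f" (at level 40, left associativity).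
Reserved Notation "τ ∘₂ σ" (at level 40, left associativity).
Reserved Notation "τ • σ" (at level 45, right associativity).
Reserved Notation "X ⊗₀ Y" (at level 35, right associativity).
Reserved Notation "f ⊗₁ g" (at level 35, right associativity).
Reserved Notation "τ ⊗₂ σ" (at level 35, right associativity).

Definition dprod (K : pzRingType) (I : Type) (M : I -> lmodType K) : Type :=
  forall i, M i.

Section DProd.
Context (K : pzRingType) (I : Type) (M : I -> lmodType K).
Implicit Types x y z : dprod M.

HB.instance Definition _ := gen_eqMixin (dprod M).
HB.instance Definition _ := gen_choiceMixin (dprod M).

Definition dprod_zero : dprod M := fun=> 0.
Definition dprod_opp x : dprod M := fun i => - x i.
Definition dprod_add x y : dprod M := fun i => x i + y i.
Definition dprod_scale (a : K) x : dprod M := fun i => a *: x i.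

Fact dprod_addA : associative dprod_add.
Proof. by move=> x y z; apply: functional_extensionality_dep => i; exact: addrA. Qed.
Fact dprod_addC : commutative dprod_add.
Proof. by move=> x y; apply: functional_extensionality_dep => i; exact: addrC. Qed.
Fact dprod_add0 : left_id dprod_zero dprod_add.
Proof. by move=> x; apply: functional_extensionality_dep => i; exact: add0r. Qed.
Fact dprod_addN : left_inverse dprod_zero dprod_opp dprod_add.
Proof. by move=> x; apply: functional_extensionality_dep => i; exact: addNr. Qed.

HB.instance Definition _ :=
  GRing.isZmodule.Build (dprod M) dprod_addA dprod_addC dprod_add0 dprod_addN.

Fact dprod_scaleA a b x : dprod_scale a (dprod_scale b x) = dprod_scale (a * b) x.
Proof. by apply: functional_extensionality_dep => i; exact: scalerA. Qed.
Fact dprod_scale1 : left_id 1 dprod_scale.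
Proof. by move=> x; apply: functional_extensionality_dep => i; exact: scale1r. Qed.
Fact dprod_scaleDr : right_distributive dprod_scale +%R.
Proof. by move=> a x y; apply: functional_extensionality_dep => i; exact: scalerDr. Qed.
Fact dprod_scaleDl x : {morph dprod_scale^~ x : a b / a + b}.
Proof. by move=> a b; apply: functional_extensionality_dep => i; exact: scalerDl. Qed.

HB.instance Definition _ := GRing.Zmodule_isLmodule.Build K (dprod M)
  dprod_scaleA dprod_scale1 dprod_scaleDr dprod_scaleDl.

End DProd.

Record category := Category {
  ob :> Type;
  hom1 : ob -> ob -> Type;
  id1 : forall X, hom1 X X;
  comp1 : forall X Y Z, hom1 Y Z -> hom1 X Y -> hom1 X Z;
  comp1A : forall X Y Z W (h : hom1 Z W) (g : hom1 Y Z) (f : hom1 X Y),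
    comp1 h (comp1 g f) = comp1 (comp1 h g) f;
  comp1_id1l : forall X Y (f : hom1 X Y), comp1 (id1 Y) f = f;
  comp1_id1r : forall X Y (f : hom1 X Y), comp1 f (id1 X) = f
}.
Arguments id1 {c}.
Arguments hom1 {c}.
Arguments comp1 {c X Y Z}.
Arguments comp1A {c X Y Z W}.
Arguments comp1_id1l {c X Y}.
Arguments comp1_id1r {c X Y}.
Notation "g ∘₁ f" := (comp1 g f) : gray_scope.

(* Strict associativity of the tensor product identifies objects that are not
   convertible, so equations between 1-morphisms are stated in the type of all
   arrows, and 2-morphisms are transported by [cast2] below. *)
Record arrow (C : category) := Arrow {
  asrc : C; atgt : C; ahom : hom1 asrc atgt }.
Arguments Arrow {C asrc atgt}.

Record bdry (C : category) := Bdry {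
  bsrc : C; btgt : C; bfrom : hom1 bsrc btgt; bto : hom1 bsrc btgt }.
Arguments Bdry {C bsrc btgt}.

Section Arrows.
Context (C : category).

Lemma arrow_inj (X Y : C) (f f' : hom1 X Y) : Arrow f = Arrow f' -> f = f'.
Proof.
move=> e.
pose P (a : arrow C) := forall (eX : asrc a = X) (eY : atgt a = Y),
  eq_rect _ (fun T => hom1 X T) (eq_rect _ (fun T => hom1 T (atgt a)) (ahom a) _ eX) _ eY = f'.
suff: P (Arrow f) by move/(_ erefl erefl).
by rewrite e => eX eY; rewrite (Prop_irrelevance eX erefl) (Prop_irrelevance eY erefl).
Qed.

Lemma bdry_eq (X Y X' Y' : C) (f g : hom1 X Y) (f' g' : hom1 X' Y') :
  Arrow f = Arrow f' -> Arrow g = Arrow g' -> Bdry f g = Bdry f' g'.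
Proof.
move=> ef.
have eX : X = X' := congr1 (@asrc C) ef.
have eY : Y = Y' := congr1 (@atgt C) ef.
by subst X' Y' => /arrow_inj->; rewrite (arrow_inj ef).
Qed.

Lemma Arrow_comp (X Y Z X' Y' Z' : C)
    (g : hom1 Y Z) (f : hom1 X Y) (g' : hom1 Y' Z') (f' : hom1 X' Y') :
  Arrow g = Arrow g' -> Arrow f = Arrow f' -> Arrow (g ∘₁ f) = Arrow (g' ∘₁ f').
Proof.
move=> eg ef.
have eX : X = X' := congr1 (@asrc C) ef.
have eY : Y = Y' := congr1 (@atgt C) ef.
have eZ : Z = Z' := congr1 (@atgt C) eg.
by subst X' Y' Z'; rewrite (arrow_inj eg) (arrow_inj ef).
Qed.

Lemma Arrow_id (X X' : C) : X = X' -> Arrow (id1 X) = Arrow (id1 X').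
Proof. by move->. Qed.

Lemma Arrow_idl (X Y : C) (f : hom1 X Y) : Arrow (id1 Y ∘₁ f) = Arrow f.
Proof. by rewrite comp1_id1l. Qed.

Lemma Arrow_idr (X Y : C) (f : hom1 X Y) : Arrow (f ∘₁ id1 X) = Arrow f.
Proof. by rewrite comp1_id1r. Qed.

Lemma Arrow_compA (X Y Z W : C) (h : hom1 Z W) (g : hom1 Y Z) (f : hom1 X Y) :
  Arrow ((h ∘₁ g) ∘₁ f) = Arrow (h ∘₁ (g ∘₁ f)).
Proof. by rewrite comp1A. Qed.

End Arrows.

Record cells (K : comPzRingType) (C : category) := Cells {
  hom2 : forall X Y : C, hom1 X Y -> hom1 X Y -> lmodType K;
  id2 : forall (X Y : C) (f : hom1 X Y), hom2 f f;
  vcomp : forall (X Y : C) (f g h : hom1 X Y), hom2 g h -> hom2 f g -> hom2 f h;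
  hcomp : forall (X Y Z : C) (g g' : hom1 Y Z) (f f' : hom1 X Y),
    hom2 g g' -> hom2 f f' -> hom2 (g ∘₁ f) (g' ∘₁ f')
}.
Arguments hom2 {K C} D {X Y} : rename.
Arguments id2 {K C} D {X Y} f : rename.
Arguments vcomp {K C D X Y f g h} : rename.
Arguments hcomp {K C D X Y Z g g' f f'} : rename.
Notation "τ • σ" := (vcomp τ σ) : gray_scope.
Notation "τ ∘₂ σ" := (hcomp τ σ) : gray_scope.

Section Cells.
Context (K : comPzRingType) (C : category) (D : cells K C).

Definition cast2 (X Y X' Y' : C) (f g : hom1 X Y) (f' g' : hom1 X' Y')
    (ef : Arrow f = Arrow f') (eg : Arrow g = Arrow g') (τ : hom2 D f g) :
    hom2 D f' g' :=
  eq_rect (Bdry f g) (fun b => hom2 D (bfrom b) (bto b)) τ (Bdry f' g')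
    (bdry_eq ef eg).

Definition castE (X Y X' Y' : C) (f : hom1 X Y) (f' : hom1 X' Y')
    (e : Arrow f = Arrow f') : hom2 D f f -> hom2 D f' f' := cast2 e e.

(* Equality of 2-morphisms whose boundaries are not convertible. *)
Record cell := Cell {
  cellb : bdry C; cell2 : hom2 D (bfrom cellb) (bto cellb) }.

Definition heq2 (X Y X' Y' : C) (f g : hom1 X Y) (f' g' : hom1 X' Y')
    (τ : hom2 D f g) (σ : hom2 D f' g') : Prop :=
  @Cell (Bdry f g) τ = @Cell (Bdry f' g') σ.

Inductive is_id2 (X Y : C) : forall f g : hom1 X Y, hom2 D f g -> Prop :=
  IsId2 f : is_id2 (id2 D f).

Definition invertible2 (X Y : C) (f g : hom1 X Y) (τ : hom2 D f g) : Prop :=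
  exists2 σ : hom2 D g f, σ • τ = id2 D f & τ • σ = id2 D g.

Record is_lin2cat : Prop := IsLin2Cat {
  vcompA : forall (X Y : C) (f g h k : hom1 X Y)
    (υ : hom2 D h k) (τ : hom2 D g h) (σ : hom2 D f g),
    υ • (τ • σ) = (υ • τ) • σ;
  vcomp_id2l : forall (X Y : C) (f g : hom1 X Y) (τ : hom2 D f g), id2 D g • τ = τ;
  vcomp_id2r : forall (X Y : C) (f g : hom1 X Y) (τ : hom2 D f g), τ • id2 D f = τ;
  hcompA : forall (X Y Z W : C) (h h' : hom1 Z W) (g g' : hom1 Y Z) (f f' : hom1 X Y)
    (υ : hom2 D h h') (τ : hom2 D g g') (σ : hom2 D f f'),
    heq2 (υ ∘₂ (τ ∘₂ σ)) ((υ ∘₂ τ) ∘₂ σ);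
  hcomp_id2l : forall (X Y : C) (f g : hom1 X Y) (τ : hom2 D f g),
    heq2 (id2 D (id1 Y) ∘₂ τ) τ;
  hcomp_id2r : forall (X Y : C) (f g : hom1 X Y) (τ : hom2 D f g),
    heq2 (τ ∘₂ id2 D (id1 X)) τ;
  hcomp_id2 : forall (X Y Z : C) (g : hom1 Y Z) (f : hom1 X Y),
    id2 D g ∘₂ id2 D f = id2 D (g ∘₁ f);
  hcomp_vcomp : forall (X Y Z : C) (g g' g'' : hom1 Y Z) (f f' f'' : hom1 X Y)
    (τ' : hom2 D g' g'') (τ : hom2 D g g') (σ' : hom2 D f' f'') (σ : hom2 D f f'),
    (τ' • τ) ∘₂ (σ' • σ) = (τ' ∘₂ σ') • (τ ∘₂ σ);
  vcomp_linearl : forall (X Y : C) (f g h : hom1 X Y) (σ : hom2 D f g),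
    linear (fun τ : hom2 D g h => τ • σ);
  vcomp_linearr : forall (X Y : C) (f g h : hom1 X Y) (τ : hom2 D g h),
    linear (fun σ : hom2 D f g => τ • σ);
  hcomp_linearl : forall (X Y Z : C) (g g' : hom1 Y Z) (f f' : hom1 X Y)
    (σ : hom2 D f f'), linear (fun τ : hom2 D g g' => τ ∘₂ σ);
  hcomp_linearr : forall (X Y Z : C) (g g' : hom1 Y Z) (f f' : hom1 X Y)
    (τ : hom2 D g g'), linear (fun σ : hom2 D f f' => τ ∘₂ σ)
}.

End Cells.

(* [thom] preserves identities but need not preserve composites: this is
   measured by the interchangers below. *)
Record tensor (C : category) := Tensor {
  tob : C -> C -> C;
  thom : forall X X' Y Y' : C, hom1 X X' -> hom1 Y Y' -> hom1 (tob X Y) (tob X' Y');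
  thom_id1 : forall X Y : C, thom (id1 X) (id1 Y) = id1 (tob X Y);
  tobA : forall X Y Z : C, tob (tob X Y) Z = tob X (tob Y Z);
  thomA : forall (X X' Y Y' Z Z' : C)
    (f : hom1 X X') (g : hom1 Y Y') (h : hom1 Z Z'),
    Arrow (thom (thom f g) h) = Arrow (thom f (thom g h))
}.

Record tcells (K : comPzRingType) (C : category) (T : tensor C) := TCells {
  cells_of :> cells K C;
  thom2 : forall (X X' Y Y' : C) (f f' : hom1 X X') (g g' : hom1 Y Y'),
    hom2 cells_of f f' -> hom2 cells_of g g' ->
    hom2 cells_of (thom T f g) (thom T f' g')
}.
Arguments thom2 {K C T} D {X X' Y Y' f f' g g'} : rename.

Section Gray.
Context (K : comPzRingType) (C : category) (T : tensor C) (D : tcells K T).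
Local Notation "X ⊗₀ Y" := (tob T X Y) : gray_scope.
Local Notation "f ⊗₁ g" := (thom T f g) : gray_scope.
Local Notation "τ ⊗₂ σ" := (thom2 D τ σ) : gray_scope.
Local Notation "τ ≅ σ" := (heq2 τ σ) (at level 70) : gray_scope.
Local Notation "1₂" := (id2 D).

Definition interchanger : Type :=
  forall (X X' X'' Y Y' Y'' : C)
    (f' : hom1 X' X'') (g' : hom1 Y' Y'') (f : hom1 X X') (g : hom1 Y Y'),
    hom2 D ((f' ⊗₁ g') ∘₁ (f ⊗₁ g)) ((f' ∘₁ f) ⊗₁ (g' ∘₁ g)).

Record is_lin_tensor : Prop := IsLinTensor {
  thom2_id2 : forall (X X' Y Y' : C) (f : hom1 X X') (g : hom1 Y Y'),
    1₂ f ⊗₂ 1₂ g = 1₂ (f ⊗₁ g);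
  thom2_vcomp : forall (X X' Y Y' : C) (f f' f'' : hom1 X X') (g g' g'' : hom1 Y Y')
    (τ' : hom2 D f' f'') (τ : hom2 D f f') (σ' : hom2 D g' g'') (σ : hom2 D g g'),
    (τ' • τ) ⊗₂ (σ' • σ) = (τ' ⊗₂ σ') • (τ ⊗₂ σ);
  thom2A : forall (X X' Y Y' Z Z' : C)
    (f f' : hom1 X X') (g g' : hom1 Y Y') (h h' : hom1 Z Z')
    (τ : hom2 D f f') (σ : hom2 D g g') (ρ : hom2 D h h'),
    (τ ⊗₂ σ) ⊗₂ ρ ≅ τ ⊗₂ (σ ⊗₂ ρ);
  thom2_linearl : forall (X X' Y Y' : C) (f f' : hom1 X X') (g g' : hom1 Y Y')
    (σ : hom2 D g g'), linear (fun τ : hom2 D f f' => τ ⊗₂ σ);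
  thom2_linearr : forall (X X' Y Y' : C) (f f' : hom1 X X') (g g' : hom1 Y Y')
    (τ : hom2 D f f'), linear (fun σ : hom2 D g g' => τ ⊗₂ σ)
}.

Record is_interchanger (t : interchanger) : Prop := IsInterchanger {
  hat_invertible : forall (X X' X'' Y Y' Y'' : C)
    (f' : hom1 X' X'') (g' : hom1 Y' Y'') (f : hom1 X X') (g : hom1 Y Y'),
    invertible2 (t _ _ _ _ _ _ f' g' f g);
  hat_natural : forall (X X' X'' Y Y' Y'' : C)
    (f' f1' : hom1 X' X'') (g' g1' : hom1 Y' Y'') (f f1 : hom1 X X') (g g1 : hom1 Y Y')
    (τ' : hom2 D f' f1') (σ' : hom2 D g' g1') (τ : hom2 D f f1) (σ : hom2 D g g1),
    t _ _ _ _ _ _ f1' g1' f1 g1 • ((τ' ⊗₂ σ') ∘₂ (τ ⊗₂ σ)) =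
    ((τ' ∘₂ τ) ⊗₂ (σ' ∘₂ σ)) • t _ _ _ _ _ _ f' g' f g;
  hat_cocycle : forall (X X' X'' X''' Y Y' Y'' Y''' : C)
    (f'' : hom1 X'' X''') (g'' : hom1 Y'' Y''') (f' : hom1 X' X'') (g' : hom1 Y' Y'')
    (f : hom1 X X') (g : hom1 Y Y'),
    t _ _ _ _ _ _ f'' g'' (f' ∘₁ f) (g' ∘₁ g) •
      (1₂ (f'' ⊗₁ g'') ∘₂ t _ _ _ _ _ _ f' g' f g) ≅
    t _ _ _ _ _ _ (f'' ∘₁ f') (g'' ∘₁ g') f g •
      (t _ _ _ _ _ _ f'' g'' f' g' ∘₂ 1₂ (f ⊗₁ g));
  hat_idl : forall (X X' Y Y' : C) (f : hom1 X X') (g : hom1 Y Y'),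
    is_id2 (t _ _ _ _ _ _ (id1 X') (id1 Y') f g);
  hat_idr : forall (X X' Y Y' : C) (f : hom1 X X') (g : hom1 Y Y'),
    is_id2 (t _ _ _ _ _ _ f g (id1 X) (id1 Y))
}.

Record is_gray (t : interchanger) : Prop := IsGray {
  gray_lin2cat : is_lin2cat D;
  gray_lin_tensor : is_lin_tensor;
  gray_hat : is_interchanger t;
  hat_cubicall : forall (X X' X'' Y Y' : C)
    (f' : hom1 X' X'') (f : hom1 X X') (g : hom1 Y Y'),
    is_id2 (t _ _ _ _ _ _ f' (id1 Y') f g);
  hat_cubicalr : forall (X X' Y Y' Y'' : C)
    (f : hom1 X X') (g' : hom1 Y' Y'') (g : hom1 Y Y'),
    is_id2 (t _ _ _ _ _ _ f g' (id1 X) g);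
  hat_assoc : forall (X X' X'' Y Y' Y'' Z Z' Z'' : C)
    (f' : hom1 X' X'') (g' : hom1 Y' Y'') (h' : hom1 Z' Z'')
    (f : hom1 X X') (g : hom1 Y Y') (h : hom1 Z Z'),
    (t _ _ _ _ _ _ f' g' f g ⊗₂ 1₂ (h' ∘₁ h)) •
      t _ _ _ _ _ _ (f' ⊗₁ g') h' (f ⊗₁ g) h ≅
    (1₂ (f' ∘₁ f) ⊗₂ t _ _ _ _ _ _ g' h' g h) •
      t _ _ _ _ _ _ f' (g' ⊗₁ h') f (g ⊗₁ h)
}.

End Gray.

Record gray_semigroup (K : comPzRingType) := GraySemigroup {
  gcat :> category;
  gtens : tensor gcat;
  gcells : tcells K gtens;
  ghat : interchanger gcells;
  grayP : is_gray ghat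
}.
Arguments gtens {K}.
Arguments gcells {K}.
Arguments ghat {K} g {X X' X'' Y Y' Y''}.

(* Iterated tensor products are nested to the right; 2-morphisms between
   differently nested ones are cast to right-nested ones. *)
Section Strictness.
Context (C : category) (T : tensor C).
Local Notation "X ⊗₀ Y" := (tob T X Y) : gray_scope.
Local Notation "f ⊗₁ g" := (thom T f g) : gray_scope.

Lemma Arrow_tens (X X' Y Y' W W' Z Z' : C)
    (f : hom1 X X') (g : hom1 Y Y') (f1 : hom1 W W') (g1 : hom1 Z Z') :
  Arrow f = Arrow f1 -> Arrow g = Arrow g1 -> Arrow (f ⊗₁ g) = Arrow (f1 ⊗₁ g1).
Proof.
move=> ef eg.
have eX : X = W := congr1 (@asrc C) ef.
have eX' : X' = W' := congr1 (@atgt C) ef.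
have eY : Y = Z := congr1 (@asrc C) eg.
have eY' : Y' = Z' := congr1 (@atgt C) eg.
by subst W W' Z Z'; rewrite (arrow_inj ef) (arrow_inj eg).
Qed.

Lemma Arrow_tensr (X X' Y Y' Z Z' : C)
    (f : hom1 X X') (g : hom1 Y Y') (g1 : hom1 Z Z') :
  Arrow g = Arrow g1 -> Arrow (f ⊗₁ g) = Arrow (f ⊗₁ g1).
Proof. exact: Arrow_tens. Qed.

Lemma Arrow_tensA3 (X X' Y Y' Z Z' W W' : C)
    (f : hom1 X X') (g : hom1 Y Y') (h : hom1 Z Z') (k : hom1 W W') :
  Arrow ((f ⊗₁ (g ⊗₁ h)) ⊗₁ k) = Arrow (f ⊗₁ (g ⊗₁ (h ⊗₁ k))).
Proof. by rewrite thomA; apply/Arrow_tensr/thomA. Qed.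

Lemma tobA3 (X Y Z W : C) :
  (X ⊗₀ (Y ⊗₀ Z)) ⊗₀ W = X ⊗₀ (Y ⊗₀ (Z ⊗₀ W)).
Proof. by rewrite !tobA. Qed.

Lemma Arrow_tens_id (X Y W : C) :
  X ⊗₀ Y = W -> Arrow (id1 X ⊗₁ id1 Y) = Arrow (id1 W).
Proof. by move<-; rewrite thom_id1. Qed.

End Strictness.

Section Semigroupal.
Context (K : comPzRingType) (C : category) (T : tensor C) (D : tcells K T).
Local Notation "X ⊗₀ Y" := (tob T X Y) : gray_scope.
Local Notation "f ⊗₁ g" := (thom T f g) : gray_scope.
Local Notation "τ ⊗₂ σ" := (thom2 D τ σ) : gray_scope.
Local Notation "1₂" := (id2 D).

Definition associator : Type :=
  forall (X X' Y Y' Z Z' : C) (f : hom1 X X') (g : hom1 Y Y') (h : hom1 Z Z'),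
    hom2 D (f ⊗₁ g ⊗₁ h) (f ⊗₁ g ⊗₁ h).

Definition pentagonator : Type :=
  forall X Y Z W : C,
    hom2 D (id1 (X ⊗₀ Y ⊗₀ Z ⊗₀ W)) (id1 (X ⊗₀ Y ⊗₀ Z ⊗₀ W)).

Record is_semigroupal (t : interchanger D) (a : associator) (p : pentagonator) :
    Prop := IsSemigroupal {
  sg_hat : is_interchanger t;
  sg_assoc_invertible : forall (X X' Y Y' Z Z' : C)
    (f : hom1 X X') (g : hom1 Y Y') (h : hom1 Z Z'),
    invertible2 (a _ _ _ _ _ _ f g h);
  sg_pent_invertible : forall X Y Z W : C, invertible2 (p X Y Z W);
  sg_assoc_natural : forall (X X' Y Y' Z Z' : C)
    (f f1 : hom1 X X') (g g1 : hom1 Y Y') (h h1 : hom1 Z Z')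
    (τ : hom2 D f f1) (σ : hom2 D g g1) (ρ : hom2 D h h1),
    a _ _ _ _ _ _ f1 g1 h1 • (τ ⊗₂ σ ⊗₂ ρ) =
    (τ ⊗₂ σ ⊗₂ ρ) • a _ _ _ _ _ _ f g h;
  sg_assoc_id : forall X Y Z : C, is_id2 (a _ _ _ _ _ _ (id1 X) (id1 Y) (id1 Z));
  sg_assoc_comp : forall (X X' X'' Y Y' Y'' Z Z' Z'' : C)
    (f' : hom1 X' X'') (g' : hom1 Y' Y'') (h' : hom1 Z' Z'')
    (f : hom1 X X') (g : hom1 Y Y') (h : hom1 Z Z'),
    a _ _ _ _ _ _ (f' ∘₁ f) (g' ∘₁ g) (h' ∘₁ h) •
      cast2 (Arrow_comp (thomA T f' g' h') (thomA T f g h))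
            (thomA T (f' ∘₁ f) (g' ∘₁ g) (h' ∘₁ h))
        ((t _ _ _ _ _ _ f' g' f g ⊗₂ 1₂ (h' ∘₁ h)) •
         t _ _ _ _ _ _ (f' ⊗₁ g') h' (f ⊗₁ g) h) =
    (1₂ (f' ∘₁ f) ⊗₂ t _ _ _ _ _ _ g' h' g h) •
      t _ _ _ _ _ _ f' (g' ⊗₁ h') f (g ⊗₁ h) •
      (a _ _ _ _ _ _ f' g' h' ∘₂ 1₂ (f ⊗₁ g ⊗₁ h)) •
      (1₂ (f' ⊗₁ g' ⊗₁ h') ∘₂ a _ _ _ _ _ _ f g h);
  sg_pent : forall (X X' Y Y' Z Z' W W' : C)
    (f : hom1 X X') (g : hom1 Y Y') (h : hom1 Z Z') (k : hom1 W W'),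
    a _ _ _ _ _ _ f g (h ⊗₁ k) •
      castE (thomA T f g (h ⊗₁ k)) (a _ _ _ _ _ _ (f ⊗₁ g) h k) •
      castE (Arrow_idr (f ⊗₁ g ⊗₁ h ⊗₁ k))
        (1₂ (f ⊗₁ g ⊗₁ h ⊗₁ k) ∘₂ p X Y Z W) =
    castE (Arrow_idl (f ⊗₁ g ⊗₁ h ⊗₁ k))
        (p X' Y' Z' W' ∘₂ 1₂ (f ⊗₁ g ⊗₁ h ⊗₁ k)) •
      (1₂ f ⊗₂ a _ _ _ _ _ _ g h k) •
      castE (Arrow_tensr T f (thomA T g h k)) (a _ _ _ _ _ _ f (g ⊗₁ h) k) •
      castE (Arrow_tensA3 T f g h k) (a _ _ _ _ _ _ f g h ⊗₂ 1₂ k);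
  sg_pent_cocycle : forall X Y Z W U : C,
    castE (Arrow_id (tobA T X Y (Z ⊗₀ W ⊗₀ U))) (p (X ⊗₀ Y) Z W U) •
      castE (Arrow_id (congr1 (fun V => X ⊗₀ Y ⊗₀ V) (tobA T Z W U)))
        (p X Y (Z ⊗₀ W) U) •
      castE (Arrow_tens_id
               (etrans (tobA3 T X Y (Z ⊗₀ W) U)
                  (congr1 (fun V => X ⊗₀ Y ⊗₀ V) (tobA T Z W U))))
        (p X Y Z W ⊗₂ 1₂ (id1 U)) =
    p X Y Z (W ⊗₀ U) •
      castE (Arrow_id (congr1 (tob T X) (tobA T Y Z (W ⊗₀ U))))
        (p X (Y ⊗₀ Z) W U) •
      castE (Arrow_tens_id erefl) (1₂ (id1 X) ⊗₂ p Y Z W U)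
}.

(* The data of a semigroupal structure on the identity 2-functor whose
   1-morphisms psi_{X,Y} are identities. *)
Definition functor_hat : Type :=
  forall (X X' Y Y' : C) (f : hom1 X X') (g : hom1 Y Y'), hom2 D (f ⊗₁ g) (f ⊗₁ g).

Definition functor_omega : Type :=
  forall X Y Z : C, hom2 D (id1 (X ⊗₀ Y ⊗₀ Z)) (id1 (X ⊗₀ Y ⊗₀ Z)).

Record is_semigroupal_id
    (t : interchanger D) (a : associator) (p : pentagonator)
    (t' : interchanger D) (a' : associator) (p' : pentagonator)
    (s : functor_hat) (w : functor_omega) : Prop := IsSemigroupalId {
  sf_hat_invertible : forall (X X' Y Y' : C) (f : hom1 X X') (g : hom1 Y Y'),
    invertible2 (s _ _ _ _ f g);
  sf_omega_invertible : forall X Y Z : C, invertible2 (w X Y Z);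
  sf_hat_natural : forall (X X' Y Y' : C) (f f1 : hom1 X X') (g g1 : hom1 Y Y')
    (τ : hom2 D f f1) (σ : hom2 D g g1),
    s _ _ _ _ f1 g1 • (τ ⊗₂ σ) = (τ ⊗₂ σ) • s _ _ _ _ f g;
  sf_hat_id : forall X Y : C, is_id2 (s _ _ _ _ (id1 X) (id1 Y));
  sf_hat_comp : forall (X X' X'' Y Y' Y'' : C)
    (f' : hom1 X' X'') (g' : hom1 Y' Y'') (f : hom1 X X') (g : hom1 Y Y'),
    s _ _ _ _ (f' ∘₁ f) (g' ∘₁ g) • t _ _ _ _ _ _ f' g' f g =
    t' _ _ _ _ _ _ f' g' f g •
      (s _ _ _ _ f' g' ∘₂ 1₂ (f ⊗₁ g)) • (1₂ (f' ⊗₁ g') ∘₂ s _ _ _ _ f g);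
  sf_assoc : forall (X X' Y Y' Z Z' : C)
    (f : hom1 X X') (g : hom1 Y Y') (h : hom1 Z Z'),
    castE (Arrow_idl (f ⊗₁ g ⊗₁ h)) (w X' Y' Z' ∘₂ 1₂ (f ⊗₁ g ⊗₁ h)) •
      (1₂ f ⊗₂ s _ _ _ _ g h) • s _ _ _ _ f (g ⊗₁ h) • a _ _ _ _ _ _ f g h =
    a' _ _ _ _ _ _ f g h •
      castE (thomA T f g h) (s _ _ _ _ f g ⊗₂ 1₂ h) •
      castE (thomA T f g h) (s _ _ _ _ (f ⊗₁ g) h) •
      castE (Arrow_idr (f ⊗₁ g ⊗₁ h)) (1₂ (f ⊗₁ g ⊗₁ h) ∘₂ w X Y Z);
  sf_pent : forall X Y Z W : C,
    castE (Arrow_id (tobA T X Y (Z ⊗₀ W))) (w (X ⊗₀ Y) Z W) •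
      w X Y (Z ⊗₀ W) • p X Y Z W =
    p' X Y Z W •
      castE (Arrow_tens_id (tobA3 T X Y Z W)) (w X Y Z ⊗₂ 1₂ (id1 W)) •
      castE (Arrow_id (congr1 (tob T X) (tobA T Y Z W))) (w X (Y ⊗₀ Z) W) •
      castE (Arrow_tens_id erefl) (1₂ (id1 X) ⊗₂ w Y Z W)
}.

End Semigroupal.

(* The pair (τ₀, τ₁) stands for τ₀ + τ₁ε, with ε² = 0. *)
Definition eps_cells (K : comPzRingType) (C : category) (D : cells K C) :
    cells K C := {|
  hom2 X Y f g := (hom2 D f g * hom2 D f g)%type : lmodType K;
  id2 X Y f := (id2 D f, 0);
  vcomp X Y f g h τ σ := (τ.1 • σ.1, τ.1 • σ.2 + τ.2 • σ.1);
  hcomp X Y Z g g' f f' τ σ := (τ.1 ∘₂ σ.1, τ.1 ∘₂ σ.2 + τ.2 ∘₂ σ.1)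
|}.

Definition eps (K : comPzRingType) (C : category) (T : tensor C)
    (D : tcells K T) : tcells K T := {|
  cells_of := eps_cells D;
  thom2 X X' Y Y' f f' g g' τ σ :=
    (thom2 D τ.1 σ.1, thom2 D τ.1 σ.2 + thom2 D τ.2 σ.1)
|}.

Section Deformations.
Context (K : comPzRingType) (C : gray_semigroup K).
Local Notation T := (gtens C).
Local Notation D := (gcells C).

Definition hat_eps (t1 : interchanger D) : interchanger (eps D) :=
  fun X X' X'' Y Y' Y'' f' g' f g => (ghat C f' g' f g, t1 _ _ _ _ _ _ f' g' f g).

Definition assoc_eps (a1 : associator D) : associator (eps D) :=
  fun X X' Y Y' Z Z' f g h =>
    (id2 D (thom T f (thom T g h)), a1 _ _ _ _ _ _ f g h).

Definition pent_eps (p1 : pentagonator D) : pentagonator (eps D) :=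
  fun X Y Z W => (id2 D (id1 (tob T X (tob T Y (tob T Z W)))), p1 X Y Z W).

Record deformation := Deformation {
  def_hat : interchanger D;
  def_assoc : associator D;
  def_pent : pentagonator D;
  defP : is_semigroupal (hat_eps def_hat) (assoc_eps def_assoc) (pent_eps def_pent)
}.

Definition psi_eps (s1 : functor_hat D) : functor_hat (eps D) :=
  fun X X' Y Y' f g => (id2 D (thom T f g), s1 _ _ _ _ f g).

Definition omega_eps (w1 : functor_omega D) : functor_omega (eps D) :=
  fun X Y Z => (id2 D (id1 (tob T X (tob T Y Z))), w1 X Y Z).

Definition def_equiv (d d' : deformation) : Prop :=
  exists (s1 : functor_hat D) (w1 : functor_omega D),
    is_semigroupal_id
      (hat_eps (def_hat d)) (assoc_eps (def_assoc d)) (pent_eps (def_pent d))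
      (hat_eps (def_hat d')) (assoc_eps (def_assoc d')) (pent_eps (def_pent d'))
      (psi_eps s1) (omega_eps w1).

End Deformations.

(* Indices are shifted: [obs n] and [homs n] are (n+1)-tuples, and [chain m]
   below has m+1 terms, so that [fam m n] further on is X^{m,n} up to
   naturality. *)
Section Tuples.
Context (C : category).

Fixpoint obs n : Type := if n is n'.+1 then (C * obs n')%type else C.

Fixpoint homs n : obs n -> obs n -> Type :=
  match n with
  | 0 => fun X Y => hom1 X Y
  | n'.+1 => fun X Y => (hom1 X.1 Y.1 * homs X.2 Y.2)%type
  end.

Fixpoint ids n : forall X : obs n, homs X X :=
  match n with
  | 0 => fun X => id1 X
  | n'.+1 => fun X => (id1 X.1, ids X.2)
  end.

Fixpoint comps n : forall X Y Z : obs n, homs Y Z -> homs X Y -> homs X Z :=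
  match n with
  | 0 => fun X Y Z g f => g ∘₁ f
  | n'.+1 => fun X Y Z g f => (g.1 ∘₁ f.1, comps g.2 f.2)
  end.

Lemma compsA n (X Y Z W : obs n) (h : homs Z W) (g : homs Y Z) (f : homs X Y) :
  comps h (comps g f) = comps (comps h g) f.
Proof.
elim: n X Y Z W h g f => [|n IHn] X Y Z W h g f /=; first exact: comp1A.
by rewrite comp1A IHn.
Qed.

Inductive is_ids n : forall X Y : obs n, homs X Y -> Prop :=
  IsIds X : is_ids (ids X).

(* f_0, ..., f_m with f_m starting at X, applied first, and f_0 ending at Z. *)
Fixpoint chain n m (X Z : obs n) : Type :=
  if m is m'.+1 then {Y : obs n & (homs Y Z * chain m' X Y)%type} else homs X Z.

Definition cob n m (X Z : obs n) (c : chain m.+1 X Z) : obs n := projT1 c.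
Definition chd n m (X Z : obs n) (c : chain m.+1 X Z) : homs (cob c) Z :=
  (projT2 c).1.
Definition ctl n m (X Z : obs n) (c : chain m.+1 X Z) : chain m X (cob c) :=
  (projT2 c).2.

Fixpoint ccomp n m : forall X Z : obs n, chain m X Z -> homs X Z :=
  match m with
  | 0 => fun X Z c => c
  | m'.+1 => fun X Z c => comps (chd c) (ccomp (ctl c))
  end.

Fixpoint has_ids n m : forall X Z : obs n, chain m X Z -> Prop :=
  match m with
  | 0 => fun X Z c => is_ids (c : homs X Z)
  | m'.+1 => fun X Z c => is_ids (chd c) \/ has_ids (ctl c)
  end.

Fixpoint cmap n n' (Fo : obs n -> obs n')
    (Fh : forall X Y : obs n, homs X Y -> homs (Fo X) (Fo Y)) m :
    forall X Z : obs n, chain m X Z -> chain m (Fo X) (Fo Z) :=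
  match m with
  | 0 => fun X Z c => Fh X Z c
  | m'.+1 => fun X Z c => existT _ (Fo (cob c))
      (Fh _ _ (chd c), cmap Fh (ctl c))
  end.

(* f_0, ..., f_i ∘ f_(i+1), ..., f_(m+1); only i <= m is meaningful. *)
Fixpoint cface n i m {struct m} : forall X Z : obs n, chain m.+1 X Z -> chain m X Z :=
  match m with
  | 0 => fun X Z c => comps (chd c) (ctl c)
  | m'.+1 =>
    match i with
    | 0 => fun X Z c =>
        let: existT Y (f, existT Y' (g, c')) := c in existT _ Y' (comps f g, c')
    | i'.+1 => fun X Z c =>
        existT _ (cob c) ((chd c), cface i' (ctl c))
    end
  end.

Fixpoint cmid n m : forall X Z : obs n, chain m.+1 X Z -> obs n :=
  match m with
  | 0 => fun X Z c => cob c
  | m'.+1 => fun X Z c => cmid (ctl c)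
  end.

Fixpoint cbut n m : forall (X Z : obs n) (c : chain m.+1 X Z), chain m (cmid c) Z :=
  match m with
  | 0 => fun X Z c => (chd c)
  | m'.+1 => fun X Z c => existT _ (cob c) ((chd c), cbut (ctl c))
  end.

Fixpoint clast n m : forall (X Z : obs n) (c : chain m.+1 X Z), homs X (cmid c) :=
  match m with
  | 0 => fun X Z c => (ctl c)
  | m'.+1 => fun X Z c => clast (ctl c)
  end.

Lemma ccomp_face n i m (X Z : obs n) (c : chain m.+1 X Z) :
  ccomp (cface i c) = ccomp c.
Proof.
elim: m i X Z c => [|m IHm] [|i] X Z [Y [f c]] //=; last by rewrite IHm.
by case: c => Y' [g c'] /=; rewrite compsA.
Qed.

Lemma ccomp_last n m (X Z : obs n) (c : chain m.+1 X Z) :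
  comps (ccomp (cbut c)) (clast c) = ccomp c.
Proof.
elim: m X Z c => [|m IHm] X Z [Y [f c]] //=.
by rewrite -compsA IHm.
Qed.

Definition headh n (X Y : obs n.+1) (f : homs X Y) : @homs 0 X.1 Y.1 := f.1.
Definition tailh n (X Y : obs n.+1) (f : homs X Y) : @homs n X.2 Y.2 := f.2.

Fixpoint inito n : obs n.+1 -> obs n :=
  match n with
  | 0 => fun X => X.1
  | n'.+1 => fun X => (X.1, inito X.2)
  end.

Fixpoint lasto n : obs n.+1 -> C :=
  match n with
  | 0 => fun X => X.2
  | n'.+1 => fun X => lasto X.2
  end.

Fixpoint inith n : forall X Y : obs n.+1, homs X Y -> homs (inito X) (inito Y) :=
  match n with
  | 0 => fun X Y f => f.1
  | n'.+1 => fun X Y f => (f.1, @inith n' _ _ f.2)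
  end.

Fixpoint lasth n : forall X Y : obs n.+1, homs X Y -> @homs 0 (lasto X) (lasto Y) :=
  match n with
  | 0 => fun X Y f => f.2
  | n'.+1 => fun X Y f => @lasth n' _ _ f.2
  end.

Definition chead n m (X Z : obs n.+1) (c : chain m X Z) : @chain 0 m X.1 Z.1 :=
  cmap (@headh n) c.
Definition ctail n m (X Z : obs n.+1) (c : chain m X Z) : @chain n m X.2 Z.2 :=
  cmap (@tailh n) c.
Definition cinith n m (X Z : obs n.+1) (c : chain m X Z) :
  chain m (inito X) (inito Z) := cmap (@inith n) c.
Definition clasth n m (X Z : obs n.+1) (c : chain m X Z) :
  @chain 0 m (lasto X) (lasto Z) := cmap (@lasth n) c.

Lemma ccomp_cmap n n' (Fo : obs n -> obs n')
    (Fh : forall X Y : obs n, homs X Y -> homs (Fo X) (Fo Y)) :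
  (forall X Y Z (g : homs Y Z) (f : homs X Y),
    Fh _ _ (comps g f) = comps (Fh _ _ g) (Fh _ _ f)) ->
  forall m X Z (c : chain m X Z), ccomp (cmap Fh c) = Fh _ _ (ccomp c).
Proof.
by move=> FhM; elim=> [|m IHm] X Z c //=; rewrite IHm FhM.
Qed.

Lemma inith_comps n (X Y Z : obs n.+1) (g : homs Y Z) (f : homs X Y) :
  inith (comps g f) = comps (inith g) (inith f).
Proof. by elim: n X Y Z g f => [|n IHn] X Y Z g f //=; rewrite IHn. Qed.

Lemma lasth_comps n (X Y Z : obs n.+1) (g : homs Y Z) (f : homs X Y) :
  lasth (comps g f) = comps (lasth g) (lasth f).
Proof. by elim: n X Y Z g f => [|n IHn] X Y Z g f //=; exact: IHn. Qed.

Lemma ccomp_head n m (X Z : obs n.+1) (c : chain m X Z) :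
  ccomp (chead c) = (ccomp c).1.
Proof. by rewrite /chead ccomp_cmap. Qed.

Lemma ccomp_tail n m (X Z : obs n.+1) (c : chain m X Z) :
  ccomp (ctail c) = (ccomp c).2.
Proof. by rewrite /ctail ccomp_cmap. Qed.

Lemma ccomp_inith n m (X Z : obs n.+1) (c : chain m X Z) :
  ccomp (cinith c) = inith (ccomp c).
Proof. by rewrite /cinith ccomp_cmap //; exact: inith_comps. Qed.

Lemma ccomp_lasth n m (X Z : obs n.+1) (c : chain m X Z) :
  ccomp (clasth c) = lasth (ccomp c).
Proof. by rewrite /clasth ccomp_cmap //; exact: lasth_comps. Qed.

End Tuples.
Arguments chain {C n}.

Section TensorTuples.
Context (C : category) (T : tensor C).
Local Notation "X ⊗₀ Y" := (tob T X Y) : gray_scope.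
Local Notation "f ⊗₁ g" := (thom T f g) : gray_scope.

Fixpoint tobs n : obs C n -> C :=
  match n with
  | 0 => fun X => X
  | n'.+1 => fun X => X.1 ⊗₀ tobs X.2
  end.

Fixpoint thoms n : forall X Y : obs C n, homs X Y -> @homs C 0 (tobs X) (tobs Y) :=
  match n with
  | 0 => fun X Y f => f
  | n'.+1 => fun X Y f => f.1 ⊗₁ thoms f.2
  end.

(* T_0, ..., T_m, where T_j is the tensor product of the tuple f_j. *)
Definition ctens n m (X Z : obs C n) (c : chain m X Z) :
  @chain C 0 m (tobs X) (tobs Z) := cmap (@thoms n) c.

Definition tcomp n m (X Z : obs C n) (c : chain m X Z) : hom1 (tobs X) (tobs Z) :=
  ccomp (ctens c).

(* f_0 ⊗ g_0, ..., f_m ⊗ g_m. *)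
Fixpoint czip m : forall X Z X' Z' : C,
    @chain C 0 m X Z -> @chain C 0 m X' Z' -> @chain C 0 m (X ⊗₀ X') (Z ⊗₀ Z') :=
  match m with
  | 0 => fun X Z X' Z' a b => a ⊗₁ b
  | m'.+1 => fun X Z X' Z' a b =>
      existT (fun Y : C => (hom1 Y (Z ⊗₀ Z') * @chain C 0 m' (X ⊗₀ X') Y)%type)
        (cob a ⊗₀ cob b)
        ((chd a) ⊗₁ (chd b), czip (ctl a) (ctl b))
  end.

(* (X^0, ..., X^i ⊗ X^(i+1), ..., X^(n+1)); only i <= n is meaningful. *)
Fixpoint fuseo i n {struct n} : obs C n.+1 -> obs C n :=
  match n with
  | 0 => fun X => X.1 ⊗₀ X.2
  | n'.+1 =>
    match i with
    | 0 => fun X => (X.1 ⊗₀ X.2.1, X.2.2)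
    | i'.+1 => fun X => (X.1, fuseo i' X.2)
    end
  end.

Fixpoint fuseh i n {struct n} : forall X Y : obs C n.+1,
    homs X Y -> homs (fuseo i X) (fuseo i Y) :=
  match n with
  | 0 => fun (X Y : obs C 1) (f : homs X Y) => @thom C T X.1 Y.1 X.2 Y.2 f.1 f.2
  | n'.+1 =>
    match i with
    | 0 => fun X Y f => (f.1 ⊗₁ f.2.1, f.2.2)
    | i'.+1 => fun X Y f => (f.1, @fuseh i' n' _ _ f.2)
    end
  end.

Definition cfuse i n m (X Z : obs C n.+1) (c : chain m X Z) :
  chain m (fuseo i X) (fuseo i Z) := cmap (@fuseh i n) c.

Lemma tobs_fuse i n (X : obs C n.+1) : tobs (fuseo i X) = tobs X.
Proof. by elim: n i X => [|n IHn] [|i] X //=; rewrite ?tobA ?IHn. Qed.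

Lemma tobs_last n (X : obs C n.+1) : tobs (inito X) ⊗₀ lasto X = tobs X.
Proof. by elim: n X => [|n IHn] X //=; rewrite tobA (IHn X.2). Qed.

Lemma thoms_fuse i n (X Y : obs C n.+1) (f : homs X Y) :
  Arrow (thoms (fuseh i f) : hom1 _ _) = Arrow (thoms f : hom1 _ _).
Proof.
elim: n i X Y f => [|n IHn] [|i] X Y f //=; first exact: thomA.
by apply: Arrow_tensr; exact: IHn.
Qed.

Lemma thoms_last n (X Y : obs C n.+1) (f : homs X Y) :
  Arrow (thoms (inith f) ⊗₁ lasth f) = Arrow (thoms f : hom1 _ _).
Proof.
elim: n X Y f => [|n IHn] X Y f //=.
by rewrite thomA; apply: Arrow_tensr; exact: IHn.
Qed.

Lemma tcomp_last n m (X Z : obs C n) (c : chain m.+1 X Z) :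
  tcomp (cbut c) ∘₁ thoms (clast c) = tcomp c.
Proof.
rewrite /tcomp /ctens; elim: m X Z c => [|m IHm] X Z [Y [f c]] //=.
rewrite -comp1A; congr (_ ∘₁ _); exact: IHm.
Qed.

Lemma tcomp_fuse i n m (X Z : obs C n.+1) (c : chain m X Z) :
  Arrow (tcomp (cfuse i c)) = Arrow (tcomp c).
Proof.
rewrite /tcomp /ctens /cfuse.
elim: m X Z c => [|m IHm] X Z c /=; first exact: thoms_fuse.
by apply: Arrow_comp; [exact: thoms_fuse | exact: IHm].
Qed.

Lemma czip_head n m (X Z : obs C n.+1) (c : chain m X Z) :
  ccomp (czip (chead c) (ctens (ctail c))) = tcomp c.
Proof.
rewrite /tcomp /ctens /chead /ctail.
by elim: m X Z c => [|m IHm] X Z c //=; rewrite IHm.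
Qed.

Lemma czip_last n m (X Z : obs C n.+1) (c : chain m X Z) :
  Arrow (ccomp (czip (ctens (cinith c)) (clasth c)) : hom1 _ _) = Arrow (tcomp c).
Proof.
rewrite /tcomp /ctens /cinith /clasth.
elim: m X Z c => [|m IHm] X Z c /=; first exact: thoms_last.
by apply: Arrow_comp; [exact: thoms_last | exact: IHm].
Qed.

Lemma thoms_ccomp n m (X Z : obs C n.+1) (c : chain m X Z) :
  ccomp (chead c) ⊗₁ thoms (ccomp (ctail c)) = thoms (ccomp c).
Proof. by rewrite ccomp_head ccomp_tail. Qed.

Lemma thoms_ccomp_last n m (X Z : obs C n.+1) (c : chain m X Z) :
  Arrow (thoms (ccomp (cinith c)) ⊗₁ ccomp (clasth c)) =
  Arrow (thoms (ccomp c) : hom1 _ _).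
Proof. by rewrite ccomp_inith ccomp_lasth; exact: thoms_last. Qed.

Lemma czip_fuse0 i m (X Z : obs C 1) (c : chain m X Z) :
  ccomp (czip (chead c) (ctail c)) = ccomp (cfuse i c).
Proof.
rewrite /chead /ctail /cfuse.
by elim: m X Z c => [|m IHm] X Z c //=; congr (_ ∘₁ _); exact: IHm.
Qed.

Lemma czip_fuse n m (X Z : obs C n.+2) (c : chain m X Z) :
  (ccomp (czip (chead c) (chead (ctail c))) : hom1 _ _) ⊗₁
    (thoms (ccomp (ctail (ctail c))) : hom1 _ _) =
  thoms (ccomp (cfuse 0 c)).
Proof.
suff -> : ccomp (cfuse 0 c) =
   (ccomp (czip (chead c) (chead (ctail c))), ccomp (ctail (ctail c))) by [].
rewrite /chead /ctail /cfuse.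
by elim: m X Z c => [|m IHm] X Z c //=; rewrite IHm.
Qed.

Lemma thoms_ccomp_fuse i n m (X Z : obs C n.+2) (c : chain m X Z) :
  (ccomp (chead c) : hom1 _ _) ⊗₁ (thoms (ccomp (cfuse i (ctail c))) : hom1 _ _) =
  thoms (ccomp (cfuse i.+1 c)).
Proof.
suff -> : ccomp (cfuse i.+1 c) = (ccomp (chead c), ccomp (cfuse i (ctail c))) by [].
rewrite /chead /ctail /cfuse.
by elim: m X Z c => [|m IHm] X Z c //=; rewrite IHm.
Qed.

Lemma thoms_fuse_ccomp0 n m (X Z : obs C n.+2) (c : chain m X Z) :
  ((ccomp (chead c) : hom1 _ _) ⊗₁ (ccomp (chead (ctail c)) : hom1 _ _)) ⊗₁
    (thoms (ccomp (ctail (ctail c))) : hom1 _ _) =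
  thoms (fuseh 0 (ccomp c)).
Proof.
suff -> : ccomp c = (ccomp (chead c),
  (ccomp (chead (ctail c)), ccomp (ctail (ctail c)))) by [].
rewrite [LHS]surjective_pairing [X in (_, X)]surjective_pairing.
congr (_, (_, _)); first exact: (esym (ccomp_head c)).
  exact: etrans (congr1 fst (esym (ccomp_tail c))) (esym (ccomp_head (ctail c))).
exact: etrans (congr1 snd (esym (ccomp_tail c))) (esym (ccomp_tail (ctail c))).
Qed.

Lemma thoms_fuse_ccompS i n m (X Z : obs C n.+2) (c : chain m X Z) :
  (ccomp (chead c) : hom1 _ _) ⊗₁ (thoms (fuseh i (ccomp (ctail c))) : hom1 _ _) =
  thoms (fuseh i.+1 (ccomp c)).
Proof.
suff -> : ccomp c = (ccomp (chead c), ccomp (ctail c)) by [].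
rewrite [LHS]surjective_pairing.
by congr (_, _);
  [exact: (esym (ccomp_head c)) | exact: (esym (ccomp_tail c))].
Qed.

Lemma thom_id_head n (X : obs C n.+1) :
  Arrow (id1 X.1 ⊗₁ id1 (tobs X.2)) = Arrow (id1 (tobs X)).
Proof. exact: Arrow_tens_id. Qed.

End TensorTuples.

Section DoubleComplex.
Context (K : comPzRingType) (C : gray_semigroup K).
Local Notation T := (gtens C).
Local Notation D := (gcells C).
Local Notation "X ⊗₀ Y" := (tob T X Y) : gray_scope.
Local Notation "f ⊗₁ g" := (thom T f g) : gray_scope.
Local Notation "τ ⊗₂ σ" := (thom2 D τ σ) : gray_scope.
Local Notation "1₂" := (id2 D).

Fixpoint homs2 n : forall X Y : obs C n, homs X Y -> homs X Y -> Type :=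
  match n with
  | 0 => fun X Y f g => hom2 D f g
  | n'.+1 => fun X Y f g => (hom2 D f.1 g.1 * homs2 f.2 g.2)%type
  end.

Fixpoint hcomps2 n : forall (X Y Z : obs C n) (g g' : homs Y Z) (f f' : homs X Y),
    homs2 g g' -> homs2 f f' -> homs2 (comps g f) (comps g' f') :=
  match n with
  | 0 => fun X Y Z g g' f f' τ σ => τ ∘₂ σ
  | n'.+1 => fun X Y Z g g' f f' τ σ => (τ.1 ∘₂ σ.1, hcomps2 τ.2 σ.2)
  end.

Fixpoint thoms2 n : forall (X Y : obs C n) (f g : homs X Y),
    homs2 f g -> hom2 D (thoms T f : hom1 _ _) (thoms T g : hom1 _ _) :=
  match n with
  | 0 => fun X Y f g τ => τ
  | n'.+1 => fun X Y f g τ => τ.1 ⊗₂ thoms2 τ.2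
  end.

(* A 2-morphism between tuples together with its source and target, so that
   sequences of them share their intermediate objects. *)
Record ncell n (X Y : obs C n) := NCell {
  nsrc : homs X Y; ntgt : homs X Y; ncell2 : homs2 nsrc ntgt }.

Fixpoint chain2 n m (X Z : obs C n) : Type :=
  if m is m'.+1 then {Y : obs C n & (ncell Y Z * chain2 m' X Y)%type}
  else ncell X Z.

Fixpoint csrc n m : forall X Z : obs C n, chain2 m X Z -> chain m X Z :=
  match m with
  | 0 => fun X Z r => nsrc r
  | m'.+1 => fun X Z r =>
      existT _ (projT1 r) (nsrc (projT2 r).1, csrc (projT2 r).2)
  end.

Fixpoint ctgt n m : forall X Z : obs C n, chain2 m X Z -> chain m X Z :=
  match m with
  | 0 => fun X Z r => ntgt r
  | m'.+1 => fun X Z r =>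
      existT _ (projT1 r) (ntgt (projT2 r).1, ctgt (projT2 r).2)
  end.

Fixpoint ccomp2 n m : forall (X Z : obs C n) (r : chain2 m X Z),
    homs2 (ccomp (csrc r)) (ccomp (ctgt r)) :=
  match m with
  | 0 => fun X Z r => ncell2 r
  | m'.+1 => fun X Z r => hcomps2 (ncell2 (projT2 r).1) (ccomp2 (projT2 r).2)
  end.

Fixpoint tcomp2 n m : forall (X Z : obs C n) (r : chain2 m X Z),
    hom2 D (tcomp T (csrc r)) (tcomp T (ctgt r)) :=
  match m with
  | 0 => fun X Z r => thoms2 (ncell2 r)
  | m'.+1 => fun X Z r => thoms2 (ncell2 (projT2 r).1) ∘₂ tcomp2 (projT2 r).2
  end.

(* All families φ(f_0,...,f_m) : T_0 ∘ ... ∘ T_m => c^0 ⊗ ... ⊗ c^n, natural or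
   not; (c^0,...,c^n) is the composite f_0 ∘ ... ∘ f_m of tuples. *)
Definition fam m n : lmodType K :=
  dprod (fun X : obs C n => dprod (fun Z : obs C n => dprod (fun c : chain m X Z =>
    hom2 D (tcomp T c) (thoms T (ccomp c) : hom1 _ _)))).

Definition natural m n (φ : fam m n) : Prop :=
  forall (X Z : obs C n) (r : chain2 m X Z),
    φ X Z (ctgt r) • tcomp2 r = thoms2 (ccomp2 r) • φ X Z (csrc r).

Definition special m n (φ : fam m n) : Prop :=
  forall (X Z : obs C n) (c : chain m X Z), has_ids c -> φ X Z c = 0.

(* Θ_2 for the pairs (a_j, b_j). *)
Fixpoint Theta2 m : forall (X Z X' Z' : C)
    (a : @chain C 0 m X Z) (b : @chain C 0 m X' Z'),
    hom2 D (ccomp (czip T a b) : hom1 _ _)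
      ((ccomp a : hom1 _ _) ⊗₁ (ccomp b : hom1 _ _)) :=
  match m with
  | 0 => fun X Z X' Z' (a : @chain C 0 0 X Z) (b : @chain C 0 0 X' Z') =>
      1₂ ((a : hom1 X Z) ⊗₁ (b : hom1 X' Z'))
  | m'.+1 => fun X Z X' Z' a b =>
      ghat C (chd a) (chd b) (ccomp (ctl a)) (ccomp (ctl b)) •
        (1₂ ((chd a) ⊗₁ (chd b)) ∘₂ Theta2 (ctl a) (ctl b))
  end.

(* Θ_(n+1)(f,g): in δ_h the 2-morphism Θ only occurs on sequences of two
   tuples. The recursion Θ_(n+1) = (1 ⊗ Θ_n) • Θ_2 starts at Θ_1 = 1 instead of
   Θ_2, and Θ_2((f,g),(f',g')) is \hat{⊗}((f,g),(f',g')); both only drop or add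
   vertical composites with identities. *)
Fixpoint Theta n : forall (X Y Z : obs C n) (f : homs Y Z) (g : homs X Y),
    hom2 D ((thoms T f : hom1 _ _) ∘₁ (thoms T g : hom1 _ _))
      (thoms T (comps f g) : hom1 _ _) :=
  match n with
  | 0 => fun X Y Z f g => 1₂ (f ∘₁ g)
  | n'.+1 => fun X Y Z f g =>
      (1₂ (f.1 ∘₁ g.1) ⊗₂ Theta f.2 g.2) •
        ghat C f.1 (thoms T f.2) g.1 (thoms T g.2)
  end.

(* 1 ∘ Θ(f_i, f_(i+1)) ∘ 1. *)
Fixpoint Theta_at n i m {struct m} : forall (X Z : obs C n) (c : chain m.+1 X Z),
    hom2 D (tcomp T c) (tcomp T (cface i c)) :=
  match m with
  | 0 => fun X Z c => Theta (chd c) (ctl c)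
  | m'.+1 =>
    match i with
    | 0 => fun X Z c =>
        match c with existT Y (f, existT Y' (g, c')) =>
          cast2 (Arrow_compA (thoms T f) (thoms T g) (tcomp T c')) erefl
            (Theta f g ∘₂ 1₂ (tcomp T c'))
        end
    | i'.+1 => fun X Z c =>
        1₂ (thoms T (chd c) : hom1 _ _) ∘₂ Theta_at i' (ctl c)
    end
  end.

Definition delta_h m n (φ : fam m n) : fam m.+1 n := fun X Z c =>
  Theta (chd c) (ccomp (ctl c)) •
    (1₂ (thoms T (chd c) : hom1 _ _) ∘₂ φ _ _ (ctl c)) +
  \sum_(i < m.+1) (-1) ^+ i.+1 *:
    cast2 erefl (congr1 (fun f => Arrow (thoms T f : hom1 _ _)) (ccomp_face i c))
      (φ _ _ (cface i c) • Theta_at i c) +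
  (-1) ^+ m.+2 *:
    cast2 (congr1 Arrow (tcomp_last T c))
      (congr1 (fun f => Arrow (thoms T f : hom1 _ _)) (ccomp_last c))
      (Theta (ccomp (cbut c)) (clast c) •
        (φ _ _ (cbut c) ∘₂ 1₂ (thoms T (clast c) : hom1 _ _))).

(* 1 ⊗ Θ_2(f^i, f^(i+1)) ⊗ 1. *)
Fixpoint Theta2_at i n {struct n} : forall m (X Z : obs C n.+1) (c : chain m X Z),
    hom2 D (thoms T (ccomp (cfuse T i c)) : hom1 _ _)
      (thoms T (fuseh T i (ccomp c)) : hom1 _ _) :=
  match n with
  | 0 => fun m X Z c =>
      cast2 (congr1 Arrow (czip_fuse0 T i c)) (congr1 Arrow (thoms_ccomp T c))
        (Theta2 (chead c) (ctail c))
  | n'.+1 =>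
    match i with
    | 0 => fun m X Z c =>
        cast2 (congr1 Arrow (czip_fuse T c)) (congr1 Arrow (thoms_fuse_ccomp0 T c))
          (Theta2 (chead c) (chead (ctail c)) ⊗₂
           1₂ (thoms T (ccomp (ctail (ctail c))) : hom1 _ _))
    | i'.+1 => fun m X Z c =>
        cast2 (congr1 Arrow (thoms_ccomp_fuse T i' c))
          (congr1 Arrow (thoms_fuse_ccompS T i' c))
          (1₂ (ccomp (chead c) : hom1 _ _) ⊗₂ Theta2_at i' (ctail c))
    end
  end.

Definition delta_v m n (φ : fam m n) : fam m n.+1 := fun X Z c =>
  cast2 (congr1 Arrow (czip_head T c)) (congr1 Arrow (thoms_ccomp T c))
    ((1₂ (ccomp (chead c) : hom1 _ _) ⊗₂ φ _ _ (ctail c)) •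
     Theta2 (chead c) (ctens T (ctail c))) +
  \sum_(i < n.+1) (-1) ^+ i.+1 *:
    cast2 (tcomp_fuse T i c) (thoms_fuse T i (ccomp c))
      (Theta2_at i c • φ _ _ (cfuse T i c)) +
  (-1) ^+ n.+2 *:
    cast2 (czip_last T c) (thoms_ccomp_last T c)
      ((φ _ _ (cinith c) ⊗₂ 1₂ (ccomp (clasth c) : hom1 _ _)) •
       Theta2 (ctens T (cinith c)) (clasth c)).

Definition pent n : lmodType K :=
  dprod (fun X : obs C n => hom2 D (id1 (tobs T X)) (id1 (tobs T X))).

Definition delta_pent n (p : pent n) : pent n.+1 := fun X =>
  castE (thom_id_head T X) (1₂ (id1 X.1) ⊗₂ p X.2) +
  \sum_(i < n.+1) (-1) ^+ i.+1 *:
    castE (Arrow_id (tobs_fuse T i X)) (p (fuseo T i X)) +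
  (-1) ^+ n.+2 *:
    castE (Arrow_tens_id (tobs_last T X)) (p (inito X) ⊗₂ 1₂ (id1 (lasto X))).

Definition pent_phi n (p : pent n) : fam 0 n := fun X Z f =>
  castE (Arrow_idl (thoms T f)) (p Z ∘₂ 1₂ (thoms T f : hom1 _ _)) -
  castE (Arrow_idr (thoms T f)) (1₂ (thoms T f : hom1 _ _) ∘₂ p X).

(* X^{m,n}_mod; the submodule X^{m,n}_{mod,s} is cut out by [in_xmod_s]. *)
Definition xmod m n : lmodType K :=
  if m is 0 then (fam 0 n * pent n.+1)%type : lmodType K else fam m n.

Definition in_xmod_s m n : xmod m n -> Prop :=
  match m with
  | 0 => fun x => natural x.1 /\ special x.1
  | m'.+1 => fun x => natural x /\ special x
  end.

Definition delta'_h m n : xmod m n -> xmod m.+1 n :=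
  match m with
  | 0 => fun x => delta_h x.1
  | m'.+1 => fun x => delta_h x
  end.

Definition delta'_v m n : xmod m n -> xmod m n.+1 :=
  match m with
  | 0 => fun x => (delta_v x.1 + pent_phi x.2, - delta_pent x.2)
  | m'.+1 => fun x => delta_v x
  end.

(* The direct sum of the X^{m,n}_mod with m + n = q and n >= 1; here n is
   written as n.+1, and the product over the third index is over proofs of the
   equation, of which there is at most one. X^q_unit is the submodule cut out
   by [in_xunit]. *)
Definition xunit q : lmodType K :=
  dprod (fun m => dprod (fun n => dprod (fun _ : (m + n.+1)%N = q => xmod m n.+1))).

Definition in_xunit q (x : xunit q) : Prop := forall m n e, in_xmod_s (x m n e).

Lemma addnS_inj m n q : (m + n.+2)%N = q.+1 -> (m + n.+1)%N = q.
Proof. by rewrite addnS => -[]. Qed.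

Definition delta_unit_h q (x : xunit q) m n :
    (m + n.+1)%N = q.+1 -> xmod m n.+1 :=
  match m with
  | 0 => fun=> 0
  | m'.+1 => fun e => (-1) ^+ n.+1 *: delta'_h (x m' n (succn_inj e))
  end.

Definition delta_unit_v q (x : xunit q) m n :
    (m + n.+1)%N = q.+1 -> xmod m n.+1 :=
  match n with
  | 0 => fun=> 0
  | n'.+1 => fun e => delta'_v (x m n' (addnS_inj e))
  end.

Definition delta_unit q (x : xunit q) : xunit q.+1 :=
  fun m n e => delta_unit_h x e + delta_unit_v x e.

Record unit_cocycle q := UnitCocycle {
  ucocycle : xunit q;
  ucocycle_in : in_xunit ucocycle;
  ucocycleP : delta_unit ucocycle = 0
}.

Definition is_unit_coboundary q : xunit q -> Prop :=
  match q with
  | 0 => fun x => x = 0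
  | q'.+1 => fun x => exists2 y : xunit q', in_xunit y & x = delta_unit y
  end.

Definition cohomologous q (x y : unit_cocycle q) : Prop :=
  is_unit_coboundary (ucocycle x - ucocycle y).

End DoubleComplex.

(* The set of classes {y | R x y} when R is an equivalence relation. *)
Definition quotient_set (A : Type) (R : A -> A -> Prop) : Type :=
  {B : A -> Prop | exists x, B = R x}.

Definition H_unit (K : comPzRingType) (C : gray_semigroup K) (q : nat) : Type :=
  quotient_set (@cohomologous K C q).

Definition deformation_classes (K : comPzRingType) (C : gray_semigroup K) : Type :=
  quotient_set (@def_equiv K C).

(* Main.v *)
Require Import Defs.
From mathcomp Require Import all_boot all_algebra.
From mathcomp Require Import boolp.

(* Since ε² = 0, every axiom of a semigroupal structure on [eps D] splits into
   its constant part, which holds because C is a Gray semigroup, and its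
   ε-part, which is linear in (⊗⁽¹⁾, a⁽¹⁾, π⁽¹⁾). The ε-parts of the axioms for
   the interchanger, the associator, the pentagon and the pentagonator are the
   components of the cocycle equation in X^{2,1}, X^{1,2}, X^{0,3} and
   pent^4, so that deformations are the same thing as 2-cocycles. Likewise the
   ε-parts of the equations for (ψ, ω) say that two cocycles differ by the
   coboundary of (-ψ, -ω). *)

Set Implicit Arguments.
Unset Strict Implicit.
Unset Printing Implicit Defensive.

Import GRing.Theory.
Local Open Scope ring_scope.
Local Open Scope gray_scope.

(** The obstacle is transport: strict associativity is an equation between non-convertible objects,
    so the differentials and the axioms carry casts that rarely agree syntactically. All comparisons
    go through [heq2], equality in the total space of 2-morphisms with their boundaries, where casts
    are invisible and every composition is a congruence. Transport acts separately on the two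
    components of a cell of [eps D], so it respects the splitting into constant part and ε-part.

    Invertibility puts no condition on ε-parts, and the remaining conditions of naturality and
    normalisation become [natural] and [special]. Only the interchanger has a constant part other
    than an identity; where all constant parts are identities, vertical composites turn into sums of
    ε-parts.

    The correspondence with cocycles is one to one before passing to classes, so the bijection of
    classes follows once the two relations are seen to match. *)

Lemma quotient_set_bij (A B : Type) (R : A -> A -> Prop) (S : B -> B -> Prop)
    (f : A -> B) (g : B -> A) : cancel f g -> cancel g f ->
    (forall x y, R x y <-> S (f x) (f y)) ->
  exists F : quotient_set R -> quotient_set S, bijective F.
Proof.
move=> fK gK RS.
(* Preimage under [g] turns the class of [x] into the class of [f x]; preimage under [f] goes
   back. *)
have RSg x : (fun y => R x (g y)) = S (f x).
  by apply/funext => y; apply/propext; rewrite RS gK.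
have SRf x : (fun y => S x (f y)) = R (g x).
  by apply/funext => y; apply/propext; rewrite RS gK.
have FP (Q : quotient_set R) : exists x, (fun y => sval Q (g y)) = S x.
  by case: Q => Q /= [x e]; exists (f x); rewrite -RSg {}e.
have GP (Q : quotient_set S) : exists x, (fun y => sval Q (f y)) = R x.
  by case: Q => Q /= [x e]; exists (g x); rewrite -SRf {}e.
exists (fun Q => exist (fun P => exists y, P = S y) _ (FP Q)),
       (fun Q => exist (fun P => exists x, P = R x) _ (GP Q)) => Q;
  by apply: eq_sig_hprop => [?|]; [exact: Prop_irrelevance |
     apply/funext => y /=; rewrite ?fK ?gK].
Qed.

Lemma linear_morphD (K : pzRingType) (U V : lmodType K) (h : U -> V) :
  linear h -> {morph h : x y / x + y}.
Proof. by move=> hL x y; have := hL 1 x y; rewrite !scale1r. Qed.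

Lemma linear_morph0 (K : pzRingType) (U V : lmodType K) (h : U -> V) :
  linear h -> h 0 = 0.
Proof. by move=> /linear_morphD hD; apply: (addrI (h 0)); rewrite -hD !addr0. Qed.

Lemma linear_morphN (K : pzRingType) (U V : lmodType K) (h : U -> V) :
  linear h -> {morph h : x / - x}.
Proof.
by move=> hL x; apply: (addrI (h x)); rewrite -linear_morphD // !subrr linear_morph0.
Qed.

(** * Transport of 2-morphisms and heterogeneous equality *)

Section Cast.
Context (K : comPzRingType) (C : category) (D : cells K C).

Lemma heq2_bdry (X Y X' Y' : C) (f g : hom1 X Y) (f' g' : hom1 X' Y')
    (τ : hom2 D f g) (σ : hom2 D f' g') :
  heq2 τ σ -> Arrow f = Arrow f' /\ Arrow g = Arrow g'.
Proof.
move=> /(congr1 (@cellb K C D)) /= e; split.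
  exact: (congr1 (fun b : bdry C => Arrow (bfrom b)) e).
exact: (congr1 (fun b : bdry C => Arrow (bto b)) e).
Qed.

(** The loop at [Bdry f g] left over by an equality in the total space is trivial by proof
    irrelevance, so nothing is transported. *)
Lemma heq2_eq (X Y : C) (f g : hom1 X Y) (τ σ : hom2 D f g) : heq2 τ σ -> τ = σ.
Proof.
move=> e.
pose P (c : cell D) := forall ec : cellb c = Bdry f g,
  eq_rect _ (fun b => hom2 D (bfrom b) (bto b)) (cell2 c) _ ec = σ.
suff: P (@Cell _ _ D (Bdry f g) τ) by move/(_ erefl).
by rewrite e => ec; rewrite (Prop_irrelevance ec erefl).
Qed.

Lemma heq2_cast (X Y X' Y' : C) (f g : hom1 X Y) (f' g' : hom1 X' Y')
    (ef : Arrow f = Arrow f') (eg : Arrow g = Arrow g') (τ : hom2 D f g) :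
  heq2 (cast2 ef eg τ) τ.
Proof.
(* Once the target boundary is a variable [b], the equation between boundaries can be eliminated. *)
rewrite /heq2 /cast2; move: (bdry_eq ef eg).
by move: {ef eg} (Bdry f' g') => b e; case: _ / e.
Qed.

Lemma heq2_castl (X Y X' Y' X'' Y'' : C) (f g : hom1 X Y) (f' g' : hom1 X' Y')
    (f'' g'' : hom1 X'' Y'') (ef : Arrow f = Arrow f') (eg : Arrow g = Arrow g')
    (τ : hom2 D f g) (σ : hom2 D f'' g'') :
  heq2 τ σ -> heq2 (cast2 ef eg τ) σ.
Proof. exact: etrans (heq2_cast _ _ _). Qed.

Lemma heq2_castr (X Y X' Y' X'' Y'' : C) (f g : hom1 X Y) (f' g' : hom1 X' Y')
    (f'' g'' : hom1 X'' Y'') (ef : Arrow f = Arrow f') (eg : Arrow g = Arrow g')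
    (τ : hom2 D f g) (σ : hom2 D f'' g'') :
  heq2 σ τ -> heq2 σ (cast2 ef eg τ).
Proof. by move=> e; exact: etrans e (esym (heq2_cast _ _ _)). Qed.

Lemma heq2P (X Y X' Y' : C) (f g : hom1 X Y) (f' g' : hom1 X' Y')
    (ef : Arrow f' = Arrow f) (eg : Arrow g' = Arrow g)
    (τ : hom2 D f g) (σ : hom2 D f' g') :
  heq2 τ σ <-> τ = cast2 ef eg σ.
Proof.
split=> [e|->]; last exact: heq2_cast.
by apply: heq2_eq; rewrite /heq2 e; exact/esym/heq2_cast.
Qed.

Lemma cast2_heq (X Y X' Y' : C) (f g : hom1 X Y) (f' g' : hom1 X' Y')
    (ef : Arrow f = Arrow f') (eg : Arrow g = Arrow g')
    (τ : hom2 D f g) (σ : hom2 D f' g') :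
  heq2 τ σ -> cast2 ef eg τ = σ.
Proof. by move=> e; apply: heq2_eq; rewrite /heq2 -e; exact: heq2_cast. Qed.

Lemma cast2_refl (X Y : C) (f g : hom1 X Y)
    (ef : Arrow f = Arrow f) (eg : Arrow g = Arrow g) (τ : hom2 D f g) :
  cast2 ef eg τ = τ.
Proof. exact: cast2_heq. Qed.

Lemma cast2_linear (X Y X' Y' : C) (f g : hom1 X Y) (f' g' : hom1 X' Y')
    (ef : Arrow f = Arrow f') (eg : Arrow g = Arrow g') :
  linear (@cast2 K C D _ _ _ _ f g f' g' ef eg).
Proof.
suff rectL (b b' : bdry C) (e : b = b') : linear (fun τ : hom2 D (bfrom b) (bto b) =>
    eq_rect b (fun b => hom2 D (bfrom b) (bto b)) τ b' e).
  exact: (rectL (Bdry f g) (Bdry f' g')).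
by case: _ / e.
Qed.

Lemma cast2D (X Y X' Y' : C) (f g : hom1 X Y) (f' g' : hom1 X' Y')
    (ef : Arrow f = Arrow f') (eg : Arrow g = Arrow g') :
  {morph (@cast2 K C D _ _ _ _ f g f' g' ef eg) : τ σ / τ + σ}.
Proof. exact/linear_morphD/cast2_linear. Qed.

Lemma cast2N (X Y X' Y' : C) (f g : hom1 X Y) (f' g' : hom1 X' Y')
    (ef : Arrow f = Arrow f') (eg : Arrow g = Arrow g') :
  {morph (@cast2 K C D _ _ _ _ f g f' g' ef eg) : τ / - τ}.
Proof. exact/linear_morphN/cast2_linear. Qed.

(** The hypotheses determine the boundaries; after substituting them, both heterogeneous equalities
    are ordinary ones. The congruences for [∘₂] and [⊗₂] work in the same way. *)
Lemma heq2_vcomp (X Y X' Y' : C) (f g h : hom1 X Y) (f' g' h' : hom1 X' Y')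
    (τ : hom2 D g h) (σ : hom2 D f g) (τ' : hom2 D g' h') (σ' : hom2 D f' g') :
  heq2 τ τ' -> heq2 σ σ' -> heq2 (τ • σ) (τ' • σ').
Proof.
move=> eτ eσ; have [ef eg] := heq2_bdry eσ; have [_ eh] := heq2_bdry eτ.
have eX := congr1 (@asrc C) ef; have eY := congr1 (@atgt C) ef.
rewrite /= in eX eY; subst X' Y'.
move: (arrow_inj ef) (arrow_inj eg) (arrow_inj eh) => ???; subst f' g' h'.
by rewrite (heq2_eq eτ) (heq2_eq eσ).
Qed.

Lemma heq2_hcomp (X Y Z X' Y' Z' : C) (g h : hom1 Y Z) (f k : hom1 X Y)
    (g' h' : hom1 Y' Z') (f' k' : hom1 X' Y')
    (τ : hom2 D g h) (σ : hom2 D f k) (τ' : hom2 D g' h') (σ' : hom2 D f' k') :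
  heq2 τ τ' -> heq2 σ σ' -> heq2 (τ ∘₂ σ) (τ' ∘₂ σ').
Proof.
move=> eτ eσ; have [ef ek] := heq2_bdry eσ; have [eg eh] := heq2_bdry eτ.
have eX := congr1 (@asrc C) ef; have eY := congr1 (@atgt C) ef.
have eZ := congr1 (@atgt C) eg.
rewrite /= in eX eY eZ; subst X' Y' Z'.
move: (arrow_inj ef) (arrow_inj ek) (arrow_inj eg) (arrow_inj eh) => ????.
by subst f' g' h' k'; rewrite (heq2_eq eτ) (heq2_eq eσ).
Qed.

Lemma heq2_id2 (X Y X' Y' : C) (f : hom1 X Y) (f' : hom1 X' Y') :
  Arrow f = Arrow f' -> heq2 (id2 D f) (id2 D f').
Proof.
move=> ef; have eX := congr1 (@asrc C) ef; have eY := congr1 (@atgt C) ef.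
by rewrite /= in eX eY; subst X' Y'; rewrite (arrow_inj ef).
Qed.

Lemma castE_id2 (X Y X' Y' : C) (f : hom1 X Y) (f' : hom1 X' Y')
  (e : Arrow f = Arrow f') : castE e (id2 D f) = id2 D f'.
Proof. by apply: cast2_heq; exact: heq2_id2. Qed.

(** Over each boundary a cell of [eps_cells D] is a pair, so transport acts on each factor. This is
    what allows axioms containing casts to be split. *)
Lemma cast2_eps (X Y X' Y' : C) (f g : hom1 X Y) (f' g' : hom1 X' Y')
    (ef : Arrow f = Arrow f') (eg : Arrow g = Arrow g')
    (τ : hom2 (eps_cells D) f g) :
  cast2 ef eg τ = (cast2 ef eg (τ.1 : hom2 D f g), cast2 ef eg (τ.2 : hom2 D f g)).
Proof.
pose rct (E : cells K C) (b b' : bdry C) (e : b = b') :=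
  fun τ => eq_rect b (fun b => hom2 E (bfrom b) (bto b)) τ b' e.
suff rctE (b b' : bdry C) (e : b = b') (x : hom2 (eps_cells D) (bfrom b) (bto b)) :
    rct _ _ _ e x = (rct D _ _ e x.1, rct D _ _ e x.2).
  exact: (rctE (Bdry f g) (Bdry f' g')).
by case: _ / e; exact: surjective_pairing.
Qed.

Lemma is_id2_eps (X Y : C) (f g : hom1 X Y) (τ : hom2 (eps_cells D) f g) :
  is_id2 τ <-> is_id2 (τ.1 : hom2 D f g) /\ τ.2 = 0.
Proof.
split=> [[]//|[]].
case: τ => /= τ0 τ1 i e; rewrite {}e.
by case: i => h; exact: (IsId2 (eps_cells D) h).
Qed.

End Cast.

Lemma heq2_thom2 (K : comPzRingType) (C : category) (T : tensor C) (D : tcells K T)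
    (X X' Y Y' V V' W W' : C) (f g : hom1 X X') (h k : hom1 Y Y')
    (f' g' : hom1 V V') (h' k' : hom1 W W')
    (τ : hom2 D f g) (σ : hom2 D h k) (τ' : hom2 D f' g') (σ' : hom2 D h' k') :
  heq2 τ τ' -> heq2 σ σ' -> heq2 (thom2 D τ σ) (thom2 D τ' σ').
Proof.
move=> eτ eσ; have [eh ek] := heq2_bdry eσ; have [ef eg] := heq2_bdry eτ.
have e1 := congr1 (@asrc C) ef; have e2 := congr1 (@atgt C) ef.
have e3 := congr1 (@asrc C) eh; have e4 := congr1 (@atgt C) eh.
rewrite /= in e1 e2 e3 e4; subst V V' W W'.
move: (arrow_inj ef) (arrow_inj ek) (arrow_inj eg) (arrow_inj eh) => ????.
by subst f' g' h' k'; rewrite (heq2_eq eτ) (heq2_eq eσ).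
Qed.

(** Strips casts on both sides and descends through composites and tensor products; it settles
    equalities whose sides differ only in their casts. *)
Ltac heq := repeat first
  [ reflexivity | apply: heq2_castl | apply: heq2_castr
  | apply: heq2_vcomp | apply: heq2_hcomp | apply: heq2_thom2 ].

(** * Alternating sums with few terms *)

Section AltSum.
Context (K : pzRingType) (V : lmodType K).

(** Splitting off two terms at a time leaves the signs of the remaining sum unchanged. *)
Lemma altsumSS n (F : 'I_n.+2 -> V) :
  \sum_(i < n.+2) (-1) ^+ i.+1 *: F i =
  - F ord0 + F (lift ord0 ord0) +
  \sum_(i < n) (-1) ^+ i.+1 *: F (lift ord0 (lift ord0 i)).
Proof.
rewrite 2!big_ord_recl expr1 scaleN1r sqrrN expr1n scale1r addrA; congr (_ + _).
by apply: eq_bigr => i _; rewrite !lift0 !exprS !mulN1r !opprK.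
Qed.

Lemma altsum1 (F : 'I_1 -> V) :
  \sum_(i < 1) (-1) ^+ i.+1 *: F i = - F ord0.
Proof. by rewrite big_ord1 expr1 scaleN1r. Qed.

Lemma altsum2 (F : 'I_2 -> V) :
  \sum_(i < 2) (-1) ^+ i.+1 *: F i = - F ord0 + F (lift ord0 ord0).
Proof. by rewrite altsumSS big_ord0 addr0. Qed.

Lemma altsum3 (F : 'I_3 -> V) :
  \sum_(i < 3) (-1) ^+ i.+1 *: F i =
  - F ord0 + F (lift ord0 ord0) - F (lift ord0 (lift ord0 ord0)).
Proof. by rewrite altsumSS altsum1. Qed.

Lemma altsum4 (F : 'I_4 -> V) :
  \sum_(i < 4) (-1) ^+ i.+1 *: F i =
  - F ord0 + F (lift ord0 ord0) - F (lift ord0 (lift ord0 ord0)) +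
  F (lift ord0 (lift ord0 (lift ord0 ord0))).
Proof. by rewrite altsumSS altsum2 addrA. Qed.

Lemma signr3 (v : V) : (-1) ^+ 3 *: v = - v.
Proof. by rewrite -signr_odd expr1 scaleN1r. Qed.

Lemma signr4 (v : V) : (-1) ^+ 4 *: v = v.
Proof. by rewrite -signr_odd expr0 scale1r. Qed.

Lemma signr5 (v : V) : (-1) ^+ 5 *: v = - v.
Proof. by rewrite -signr_odd expr1 scaleN1r. Qed.

End AltSum.

(** * The differentials in the low degrees that occur *)

Section LowDegree.
Context (K : comPzRingType) (C : gray_semigroup K).
Local Notation T := (gtens C).
Local Notation D := (gcells C).
Local Notation "X ⊗₀ Y" := (tob T X Y) : gray_scope.
Local Notation "f ⊗₁ g" := (thom T f g) : gray_scope.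
Local Notation "τ ⊗₂ σ" := (thom2 D τ σ) : gray_scope.
Local Notation "1₂" := (id2 D).

Let G := grayP C.
Let G2 := gray_lin2cat G.
Let GT := gray_lin_tensor G.

(** An interchanger is evaluated on a chain of two pairs, hence has bidegree (1,1). One triple gives
    bidegree (0,2) for the associator, one pair (0,1) for ψ; four objects give [pent C 3] for π and
    three [pent C 2] for ω. *)
Definition fam_hat (t : interchanger D) : fam C 1 1 := fun X Z c =>
  t _ _ _ _ _ _ (chd c).1 (chd c).2 (ctl c).1 (ctl c).2.

Definition fam_assoc (a : associator D) : fam C 0 2 := fun X Z f =>
  a _ _ _ _ _ _ f.1 f.2.1 f.2.2.

Definition fam_psi (s : functor_hat D) : fam C 0 1 := fun X Z f =>
  s _ _ _ _ f.1 f.2.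

Definition pent_of (p : pentagonator D) : pent C 3 := fun X =>
  p X.1 X.2.1 X.2.2.1 X.2.2.2.

Definition pent_omega (w : functor_omega D) : pent C 2 := fun X =>
  w X.1 X.2.1 X.2.2.

Definition chain1 n (X Y Z : obs C n) (f : homs Y Z) (g : homs X Y) : chain 1 X Z :=
  existT _ Y (f, g).

Definition chain_cons n m (X Y Z : obs C n) (f : homs Y Z) (c : chain m X Y) :
  chain m.+1 X Z := existT _ Y (f, c).

(** This and the next four definitions curry what the [fam_] and [pent_] definitions uncurry.
    Currying after uncurrying is the identity by conversion; the other composite is the identity
    only after destructing the tuples, since pairs have no definitional eta. *)
Definition hat_of (φ : fam C 1 1) : interchanger D :=
  fun X X' X'' Y Y' Y'' f' g' f g =>
  φ (X, Y) (X'', Y'') (@chain1 1 (X, Y) (X', Y') (X'', Y'') (f', g') (f, g)).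

Definition assoc_of (φ : fam C 0 2) : associator D :=
  fun X X' Y Y' Z Z' f g h => φ (X, (Y, Z)) (X', (Y', Z')) (f, (g, h)).

Definition psi_of (φ : fam C 0 1) : functor_hat D :=
  fun X X' Y Y' f g => φ (X, Y) (X', Y') (f, g).

Definition pentagonator_of (p : pent C 3) : pentagonator D :=
  fun X Y Z W => p (X, (Y, (Z, W))).

Definition omega_of (p : pent C 2) : functor_omega D :=
  fun X Y Z => p (X, (Y, Z)).

Lemma delta_h_psi (s : functor_hat D) (X X' X'' Y Y' Y'' : C)
    (f' : hom1 X' X'') (g' : hom1 Y' Y'') (f : hom1 X X') (g : hom1 Y Y') :
  hat_of (delta_h (fam_psi s)) f' g' f g =
  ghat C f' g' f g • (1₂ (f' ⊗₁ g') ∘₂ s _ _ _ _ f g) -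
  s _ _ _ _ (f' ∘₁ f) (g' ∘₁ g) • ghat C f' g' f g +
  ghat C f' g' f g • (s _ _ _ _ f' g' ∘₂ 1₂ (f ⊗₁ g)).
Proof.
rewrite /hat_of /delta_h big_ord1 /= !(thom2_id2 GT) !(vcomp_id2l G2).
by rewrite !cast2_refl expr1 expr2 mulrNN mul1r scale1r scaleN1r.
Qed.

Lemma delta_v_psi (s : functor_hat D) (X X' Y Y' Z Z' : C)
    (f : hom1 X X') (g : hom1 Y Y') (h : hom1 Z Z') :
  assoc_of (delta_v (fam_psi s)) f g h =
  1₂ f ⊗₂ s _ _ _ _ g h - castE (thomA T f g h) (s _ _ _ _ (f ⊗₁ g) h) +
  s _ _ _ _ f (g ⊗₁ h) - castE (thomA T f g h) (s _ _ _ _ f g ⊗₂ 1₂ h).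
Proof.
rewrite /assoc_of /delta_v altsum2 signr3 /= !cast2_refl !(thom2_id2 GT).
rewrite !(vcomp_id2r G2) !(vcomp_id2l G2) !addrA.
(* The identity factors of Θ are gone; the summands now match one by one up to casts. *)
by congr (_ - _ + _ - _); apply: heq2_eq; heq.
Qed.

Lemma delta_h_hat (t : interchanger D) (X X' X'' X''' Y Y' Y'' Y''' : C)
    (f'' : hom1 X'' X''') (g'' : hom1 Y'' Y''') (f' : hom1 X' X'') (g' : hom1 Y' Y'')
    (f : hom1 X X') (g : hom1 Y Y') :
  delta_h (fam_hat t)
    (@chain_cons 1 1 (X, Y) (X'', Y'') (X''', Y''') (f'', g'')
      (@chain1 1 (X, Y) (X', Y') (X'', Y'') (f', g') (f, g))) =
  ghat C f'' g'' (f' ∘₁ f) (g' ∘₁ g) • (1₂ (f'' ⊗₁ g'') ∘₂ t _ _ _ _ _ _ f' g' f g) -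
  cast2 (Arrow_compA (f'' ⊗₁ g'') (f' ⊗₁ g') (f ⊗₁ g))
    (Arrow_tens T (Arrow_compA f'' f' f) (Arrow_compA g'' g' g))
    (t _ _ _ _ _ _ (f'' ∘₁ f') (g'' ∘₁ g') f g • (ghat C f'' g'' f' g' ∘₂ 1₂ (f ⊗₁ g))) +
  t _ _ _ _ _ _ f'' g'' (f' ∘₁ f) (g' ∘₁ g) • (1₂ (f'' ⊗₁ g'') ∘₂ ghat C f' g' f g) -
  cast2 (Arrow_compA (f'' ⊗₁ g'') (f' ⊗₁ g') (f ⊗₁ g))
    (Arrow_tens T (Arrow_compA f'' f' f) (Arrow_compA g'' g' g))
    (ghat C (f'' ∘₁ f') (g'' ∘₁ g') f g • (t _ _ _ _ _ _ f'' g'' f' g' ∘₂ 1₂ (f ⊗₁ g))).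
Proof.
rewrite /delta_h altsum2 signr3 /= !(thom2_id2 GT) !(vcomp_id2l G2) addrA.
by congr (_ - _ + _ - _); apply: heq2_eq; heq.
Qed.

Lemma delta_h_assoc (a : associator D) (X X' X'' Y Y' Y'' Z Z' Z'' : C)
    (f' : hom1 X' X'') (g' : hom1 Y' Y'') (h' : hom1 Z' Z'')
    (f : hom1 X X') (g : hom1 Y Y') (h : hom1 Z Z') :
  delta_h (fam_assoc a)
    (@chain1 2 (X, (Y, Z)) (X', (Y', Z')) (X'', (Y'', Z'')) (f', (g', h')) (f, (g, h))) =
  (1₂ (f' ∘₁ f) ⊗₂ ghat C g' h' g h • ghat C f' (g' ⊗₁ h') f (g ⊗₁ h)) •
    (1₂ (f' ⊗₁ g' ⊗₁ h') ∘₂ a _ _ _ _ _ _ f g h) -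
  a _ _ _ _ _ _ (f' ∘₁ f) (g' ∘₁ g) (h' ∘₁ h) •
    (1₂ (f' ∘₁ f) ⊗₂ ghat C g' h' g h • ghat C f' (g' ⊗₁ h') f (g ⊗₁ h)) +
  (1₂ (f' ∘₁ f) ⊗₂ ghat C g' h' g h • ghat C f' (g' ⊗₁ h') f (g ⊗₁ h)) •
    (a _ _ _ _ _ _ f' g' h' ∘₂ 1₂ (f ⊗₁ g ⊗₁ h)).
Proof.
rewrite /delta_h altsum1 expr2 mulrNN mul1r scale1r /=.
rewrite !(thom2_id2 GT) !(vcomp_id2l G2).
by congr (_ - _ + _); apply: heq2_eq; heq.
Qed.

Lemma delta_v_hat (t : interchanger D) (X X' X'' Y Y' Y'' Z Z' Z'' : C)
    (f' : hom1 X' X'') (g' : hom1 Y' Y'') (h' : hom1 Z' Z'')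
    (f : hom1 X X') (g : hom1 Y Y') (h : hom1 Z Z') :
  delta_v (fam_hat t)
    (@chain1 2 (X, (Y, Z)) (X', (Y', Z')) (X'', (Y'', Z'')) (f', (g', h')) (f, (g, h))) =
  (1₂ (f' ∘₁ f) ⊗₂ t _ _ _ _ _ _ g' h' g h) • ghat C f' (g' ⊗₁ h') f (g ⊗₁ h) -
  cast2 (Arrow_comp (thomA T f' g' h') (thomA T f g h))
        (thomA T (f' ∘₁ f) (g' ∘₁ g) (h' ∘₁ h))
    ((ghat C f' g' f g ⊗₂ 1₂ (h' ∘₁ h)) • t _ _ _ _ _ _ (f' ⊗₁ g') h' (f ⊗₁ g) h) +
  (1₂ (f' ∘₁ f) ⊗₂ ghat C g' h' g h) • t _ _ _ _ _ _ f' (g' ⊗₁ h') f (g ⊗₁ h) -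
  cast2 (Arrow_comp (thomA T f' g' h') (thomA T f g h))
        (thomA T (f' ∘₁ f) (g' ∘₁ g) (h' ∘₁ h))
    ((t _ _ _ _ _ _ f' g' f g ⊗₂ 1₂ (h' ∘₁ h)) • ghat C (f' ⊗₁ g') h' (f ⊗₁ g) h).
Proof.
rewrite /delta_v altsum2 signr3 /= !(hcomp_id2 G2) !(vcomp_id2r G2) !addrA.
by congr (_ - _ + _ - _); apply: heq2_eq; heq.
Qed.

Lemma delta_v_assoc (a : associator D) (X X' Y Y' Z Z' W W' : C)
    (f : hom1 X X') (g : hom1 Y Y') (h : hom1 Z Z') (k : hom1 W W') :
  delta_v (fam_assoc a) ((f, (g, (h, k))) : @homs C 3 (X, (Y, (Z, W))) (X', (Y', (Z', W')))) =
  1₂ f ⊗₂ a _ _ _ _ _ _ g h k -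
  castE (thomA T f g (h ⊗₁ k)) (a _ _ _ _ _ _ (f ⊗₁ g) h k) +
  castE (Arrow_tensr T f (thomA T g h k)) (a _ _ _ _ _ _ f (g ⊗₁ h) k) -
  a _ _ _ _ _ _ f g (h ⊗₁ k) +
  castE (Arrow_tensA3 T f g h k) (a _ _ _ _ _ _ f g h ⊗₂ 1₂ k).
Proof.
rewrite /delta_v altsum3 signr4 /= !cast2_refl !(thom2_id2 GT).
rewrite !(vcomp_id2r G2) !(vcomp_id2l G2) !addrA.
by congr (_ - _ + _ - _ + _); apply: heq2_eq; heq.
Qed.

Lemma pent_phiE (p : pentagonator D) (X X' Y Y' Z Z' W W' : C)
    (f : hom1 X X') (g : hom1 Y Y') (h : hom1 Z Z') (k : hom1 W W') :
  pent_phi (pent_of p) ((f, (g, (h, k))) : @homs C 3 (X, (Y, (Z, W))) (X', (Y', (Z', W')))) =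
  castE (Arrow_idl (f ⊗₁ g ⊗₁ h ⊗₁ k)) (p X' Y' Z' W' ∘₂ 1₂ (f ⊗₁ g ⊗₁ h ⊗₁ k)) -
  castE (Arrow_idr (f ⊗₁ g ⊗₁ h ⊗₁ k)) (1₂ (f ⊗₁ g ⊗₁ h ⊗₁ k) ∘₂ p X Y Z W).
Proof. by []. Qed.

Lemma pent_phi_omegaE (w : functor_omega D) (X X' Y Y' Z Z' : C)
    (f : hom1 X X') (g : hom1 Y Y') (h : hom1 Z Z') :
  pent_phi (pent_omega w) ((f, (g, h)) : @homs C 2 (X, (Y, Z)) (X', (Y', Z'))) =
  castE (Arrow_idl (f ⊗₁ g ⊗₁ h)) (w X' Y' Z' ∘₂ 1₂ (f ⊗₁ g ⊗₁ h)) -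
  castE (Arrow_idr (f ⊗₁ g ⊗₁ h)) (1₂ (f ⊗₁ g ⊗₁ h) ∘₂ w X Y Z).
Proof. by []. Qed.

Lemma delta_pentE (p : pentagonator D) (X Y Z W U : C) :
  delta_pent (pent_of p) ((X, (Y, (Z, (W, U)))) : obs C 4) =
  castE (Arrow_tens_id erefl) (1₂ (id1 X) ⊗₂ p Y Z W U) -
  castE (Arrow_id (tobA T X Y (Z ⊗₀ W ⊗₀ U))) (p (X ⊗₀ Y) Z W U) +
  castE (Arrow_id (congr1 (tob T X) (tobA T Y Z (W ⊗₀ U)))) (p X (Y ⊗₀ Z) W U) -
  castE (Arrow_id (congr1 (fun V => X ⊗₀ Y ⊗₀ V) (tobA T Z W U)))
    (p X Y (Z ⊗₀ W) U) +
  p X Y Z (W ⊗₀ U) -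
  castE (Arrow_tens_id
           (etrans (tobA3 T X Y (Z ⊗₀ W) U)
              (congr1 (fun V => X ⊗₀ Y ⊗₀ V) (tobA T Z W U))))
    (p X Y Z W ⊗₂ 1₂ (id1 U)).
Proof.
rewrite /delta_pent altsum4 signr5 !addrA.
by congr (_ - _ + _ - _ + _ - _); apply: heq2_eq; heq.
Qed.

Lemma delta_pent_omegaE (w : functor_omega D) (X Y Z W : C) :
  delta_pent (pent_omega w) ((X, (Y, (Z, W))) : obs C 3) =
  castE (Arrow_tens_id erefl) (1₂ (id1 X) ⊗₂ w Y Z W) -
  castE (Arrow_id (tobA T X Y (Z ⊗₀ W))) (w (X ⊗₀ Y) Z W) +
  castE (Arrow_id (congr1 (tob T X) (tobA T Y Z W))) (w X (Y ⊗₀ Z) W) -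
  w X Y (Z ⊗₀ W) +
  castE (Arrow_tens_id (tobA3 T X Y Z W)) (w X Y Z ⊗₂ 1₂ (id1 W)).
Proof.
rewrite /delta_pent altsum3 signr4 !addrA.
by congr (_ - _ + _ - _ + _); apply: heq2_eq; heq.
Qed.

End LowDegree.

(** With this and its variants each comparison of an ε-part with a differential becomes an identity
    between sums of the same terms, for which [ACl] gives the permutation. *)
Lemma eq_subr0P (V : zmodType) (x y z : V) : z = x - y -> (x = y <-> z = 0).
Proof.
by move=> ->; split=> [->|/eqP]; rewrite ?subrr // subr_eq0 => /eqP.
Qed.

Lemma eq_subrP (V : zmodType) (x y z w : V) : x - y = z - w -> (x = y <-> z = w).
Proof.
move=> e; have [h1 h2] := eq_subr0P (esym e); have [k1 k2] := @eq_subr0P _ z w _ erefl.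
by split=> [/h1/k2|/k1/h2].
Qed.

Lemma eq_subr0PC (V : zmodType) (x y z : V) : z = y - x -> (x = y <-> z = 0).
Proof. by move=> e; have [h1 h2] := eq_subr0P e; split=> [/esym/h1|/h2/esym]. Qed.

(** * ε-parts of the axioms as components of the differentials *)

Section Translate.
Context (K : comPzRingType) (C : gray_semigroup K).
Local Notation T := (gtens C).
Local Notation D := (gcells C).
Local Notation "X ⊗₀ Y" := (tob T X Y) : gray_scope.
Local Notation "f ⊗₁ g" := (thom T f g) : gray_scope.
Local Notation "τ ⊗₂ σ" := (thom2 D τ σ) : gray_scope.
Local Notation "1₂" := (id2 D).

Let G := grayP C.
Let G2 := gray_lin2cat G.
Let GT := gray_lin_tensor G.
Let GH := gray_hat G.

Lemma vcompDl X Y (f g h : hom1 X Y) (σ : hom2 D f g) (τ τ' : hom2 D g h) :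
  (τ + τ') • σ = τ • σ + τ' • σ.
Proof. exact: (linear_morphD (vcomp_linearl G2 σ)). Qed.

Lemma vcompDr X Y (f g h : hom1 X Y) (τ : hom2 D g h) (σ σ' : hom2 D f g) :
  τ • (σ + σ') = τ • σ + τ • σ'.
Proof. exact: (linear_morphD (vcomp_linearr G2 τ)). Qed.

Lemma vcompNl X Y (f g h : hom1 X Y) (σ : hom2 D f g) (τ : hom2 D g h) :
  (- τ) • σ = - (τ • σ).
Proof. exact: (linear_morphN (vcomp_linearl G2 σ)). Qed.

Lemma vcompNr X Y (f g h : hom1 X Y) (τ : hom2 D g h) (σ : hom2 D f g) :
  τ • (- σ) = - (τ • σ).
Proof. exact: (linear_morphN (vcomp_linearr G2 τ)). Qed.

Lemma vcomp0l X Y (f g h : hom1 X Y) (σ : hom2 D f g) : (0 : hom2 D g h) • σ = 0.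
Proof. exact: (linear_morph0 (vcomp_linearl G2 σ)). Qed.

Lemma vcomp0r X Y (f g h : hom1 X Y) (τ : hom2 D g h) : τ • (0 : hom2 D f g) = 0.
Proof. exact: (linear_morph0 (vcomp_linearr G2 τ)). Qed.

Lemma hcompDl X Y Z (g g' : hom1 Y Z) (f f' : hom1 X Y) (σ : hom2 D f f')
    (τ τ' : hom2 D g g') : (τ + τ') ∘₂ σ = τ ∘₂ σ + τ' ∘₂ σ.
Proof. exact: (linear_morphD (hcomp_linearl G2 σ)). Qed.

Lemma hcompDr X Y Z (g g' : hom1 Y Z) (f f' : hom1 X Y) (τ : hom2 D g g')
    (σ σ' : hom2 D f f') : τ ∘₂ (σ + σ') = τ ∘₂ σ + τ ∘₂ σ'.
Proof. exact: (linear_morphD (hcomp_linearr G2 τ)). Qed.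

Lemma hcomp0l X Y Z (g g' : hom1 Y Z) (f f' : hom1 X Y) (σ : hom2 D f f') :
  (0 : hom2 D g g') ∘₂ σ = 0.
Proof. exact: (linear_morph0 (hcomp_linearl G2 σ)). Qed.

Lemma hcomp0r X Y Z (g g' : hom1 Y Z) (f f' : hom1 X Y) (τ : hom2 D g g') :
  τ ∘₂ (0 : hom2 D f f') = 0.
Proof. exact: (linear_morph0 (hcomp_linearr G2 τ)). Qed.

Lemma thom2Dl X X' Y Y' (f f' : hom1 X X') (g g' : hom1 Y Y') (σ : hom2 D g g')
    (τ τ' : hom2 D f f') : (τ + τ') ⊗₂ σ = τ ⊗₂ σ + τ' ⊗₂ σ.
Proof. exact: (linear_morphD (thom2_linearl GT σ)). Qed.

Lemma thom2Dr X X' Y Y' (f f' : hom1 X X') (g g' : hom1 Y Y') (τ : hom2 D f f')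
    (σ σ' : hom2 D g g') : τ ⊗₂ (σ + σ') = τ ⊗₂ σ + τ ⊗₂ σ'.
Proof. exact: (linear_morphD (thom2_linearr GT τ)). Qed.

Lemma thom20l X X' Y Y' (f f' : hom1 X X') (g g' : hom1 Y Y') (σ : hom2 D g g') :
  (0 : hom2 D f f') ⊗₂ σ = 0.
Proof. exact: (linear_morph0 (thom2_linearl GT σ)). Qed.

Lemma thom20r X X' Y Y' (f f' : hom1 X X') (g g' : hom1 Y Y') (τ : hom2 D f f') :
  τ ⊗₂ (0 : hom2 D g g') = 0.
Proof. exact: (linear_morph0 (thom2_linearr GT τ)). Qed.

Lemma hcompNl X Y Z (g g' : hom1 Y Z) (f f' : hom1 X Y) (σ : hom2 D f f')
    (τ : hom2 D g g') : (- τ) ∘₂ σ = - (τ ∘₂ σ).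
Proof. exact: (linear_morphN (hcomp_linearl G2 σ)). Qed.

Lemma hcompNr X Y Z (g g' : hom1 Y Z) (f f' : hom1 X Y) (τ : hom2 D g g')
    (σ : hom2 D f f') : τ ∘₂ (- σ) = - (τ ∘₂ σ).
Proof. exact: (linear_morphN (hcomp_linearr G2 τ)). Qed.

Lemma thom2Nl X X' Y Y' (f f' : hom1 X X') (g g' : hom1 Y Y') (σ : hom2 D g g')
    (τ : hom2 D f f') : (- τ) ⊗₂ σ = - (τ ⊗₂ σ).
Proof. exact: (linear_morphN (thom2_linearl GT σ)). Qed.

Lemma thom2Nr X X' Y Y' (f f' : hom1 X X') (g g' : hom1 Y Y') (τ : hom2 D f f')
    (σ : hom2 D g g') : τ ⊗₂ (- σ) = - (τ ⊗₂ σ).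
Proof. exact: (linear_morphN (thom2_linearr GT τ)). Qed.

Lemma eps_eq (X Y : C) (f g : hom1 X Y) (τ σ : hom2 (eps D) f g) :
  τ.1 = σ.1 -> τ.2 = σ.2 -> τ = σ.
Proof. by case: τ σ => [? ?] [? ?] /= -> ->. Qed.

Lemma eps_eqP (X Y : C) (f g : hom1 X Y) (τ σ : hom2 (eps D) f g) :
  τ.1 = σ.1 -> (τ = σ <-> τ.2 = σ.2).
Proof. by move=> e; split=> [->//|]; exact: eps_eq. Qed.

Lemma invertible2_eps (X Y : C) (f g : hom1 X Y) (τ : hom2 (eps D) f g) :
  invertible2 (τ.1 : hom2 D f g) -> invertible2 τ.
Proof.
case: τ => τ0 τ1 /= [σ στ τσ].
(* The inverse of τ0 + τ1 ε is σ - σ τ1 σ ε with σ inverse to τ0: the geometric series, cut off by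
   ε² = 0. *)
exists ((σ, - (σ • (τ1 • σ))) : hom2 (eps D) g f); apply: eps_eq => //=.
  by rewrite vcompNl -!(vcompA G2) στ (vcomp_id2r G2) subrr.
by rewrite vcompNr (vcompA G2) τσ (vcomp_id2l G2) addNr.
Qed.

Lemma invertible2_id2 (X Y : C) (f : hom1 X Y) : invertible2 (1₂ f).
Proof. by exists (1₂ f); rewrite (vcomp_id2l G2). Qed.

Lemma is_id2_id2 (X Y : C) (f : hom1 X Y) (τ : hom2 D f f) :
  is_id2 (((1₂ f, τ) : hom2 (eps D) f f)) <-> τ = 0.
Proof.
by split=> [/is_id2_eps[]//|->]; apply/is_id2_eps; split; [exact: IsId2|].
Qed.

Definition hat_nat (t : interchanger D) :=
  forall (X X' X'' Y Y' Y'' : C)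
    (f' f1' : hom1 X' X'') (g' g1' : hom1 Y' Y'') (f f1 : hom1 X X') (g g1 : hom1 Y Y')
    (τ' : hom2 D f' f1') (σ' : hom2 D g' g1') (τ : hom2 D f f1) (σ : hom2 D g g1),
    t _ _ _ _ _ _ f1' g1' f1 g1 • ((τ' ⊗₂ σ') ∘₂ (τ ⊗₂ σ)) =
    ((τ' ∘₂ τ) ⊗₂ (σ' ∘₂ σ)) • t _ _ _ _ _ _ f' g' f g.

Definition assoc_nat (a : associator D) :=
  forall (X X' Y Y' Z Z' : C)
    (f f1 : hom1 X X') (g g1 : hom1 Y Y') (h h1 : hom1 Z Z')
    (τ : hom2 D f f1) (σ : hom2 D g g1) (ρ : hom2 D h h1),
    a _ _ _ _ _ _ f1 g1 h1 • (τ ⊗₂ σ ⊗₂ ρ) =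
    (τ ⊗₂ σ ⊗₂ ρ) • a _ _ _ _ _ _ f g h.

Definition psi_nat (s : functor_hat D) :=
  forall (X X' Y Y' : C) (f f1 : hom1 X X') (g g1 : hom1 Y Y')
    (τ : hom2 D f f1) (σ : hom2 D g g1),
    s _ _ _ _ f1 g1 • (τ ⊗₂ σ) = (τ ⊗₂ σ) • s _ _ _ _ f g.

Lemma natural_fam_hat (t : interchanger D) : natural (fam_hat t) <-> hat_nat t.
Proof.
split=> [H X X' X'' Y Y' Y'' f' f1' g' g1' f f1 g g1 τ' σ' τ σ|H].
  pose r1 : ncell ((X', Y') : obs C 1) (X'', Y'') :=
    @NCell _ _ 1 (X', Y') (X'', Y'') (f', g') (f1', g1') (τ', σ').
  pose r2 : ncell ((X, Y) : obs C 1) (X', Y') :=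
    @NCell _ _ 1 (X, Y) (X', Y') (f, g) (f1, g1) (τ, σ).
  exact: (H (X, Y) (X'', Y'') (existT _ (X', Y') (r1, r2))).
move=> [X Y] [X'' Y''] [[X' Y'] [[[f' g'] [f1' g1'] [τ' σ']] [[f g] [f1 g1] [τ σ]]]].
exact: H.
Qed.

Lemma special_fam_hat (t : interchanger D) : special (fam_hat t) <->
  (forall (X X' Y Y' : C) (f : hom1 X X') (g : hom1 Y Y'),
    t _ _ _ _ _ _ (id1 X') (id1 Y') f g = 0 /\
    t _ _ _ _ _ _ f g (id1 X) (id1 Y) = 0).
Proof.
split=> [H X X' Y Y' f g|H].
  split.
    apply: (H (X, Y) (X', Y')
      (@chain1 _ C 1 (X, Y) (X', Y') (X', Y') (id1 _, id1 _) (f, g))).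
    by left; exact: (@IsIds _ 1 (X', Y')).
  apply: (H (X, Y) (X', Y')
    (@chain1 _ C 1 (X, Y) (X, Y) (X', Y') (f, g) (id1 _, id1 _))).
  by right; exact: (@IsIds _ 1 (X, Y)).
move=> X Z [Y [f' f]]; rewrite /= /chd /ctl /= => -[] i.
  (* Eliminating [is_ids] replaces the intermediate object, so the other tuple of the chain is
     generalised along with it. *)
  by case: i f => -[A B]; case: X => X1 X2 [p q]; exact: (H _ _ _ _ p q).1.
by case: i f' => -[A B]; case: Z => Z1 Z2 [p q]; exact: (H _ _ _ _ p q).2.
Qed.

Lemma hat_eps_natural (t : interchanger D) : hat_nat t ->
  forall (X X' X'' Y Y' Y'' : C)
    (f' f1' : hom1 X' X'') (g' g1' : hom1 Y' Y'') (f f1 : hom1 X X') (g g1 : hom1 Y Y')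
    (τ' : hom2 (eps D) f' f1') (σ' : hom2 (eps D) g' g1')
    (τ : hom2 (eps D) f f1) (σ : hom2 (eps D) g g1),
    hat_eps t f1' g1' f1 g1 • (thom2 (eps D) τ' σ' ∘₂ thom2 (eps D) τ σ) =
    (thom2 (eps D) (τ' ∘₂ τ) (σ' ∘₂ σ)) • hat_eps t f' g' f g.
Proof.
move=> tN X X' X'' Y Y' Y'' f' f1' g' g1' f f1 g g1.
move=> [τ' τ1'] [σ' σ1'] [τ τ1] [σ σ1]; apply: eps_eq => /=.
  exact: hat_natural.
rewrite !(hcompDl, hcompDr, thom2Dl, thom2Dr, vcompDl, vcompDr).
(* Besides the term in [t] there are four, each with one argument replaced by its ε-part; naturality
   of the undeformed interchanger handles them, up to their order. *)
rewrite tN -!(hat_natural GH) [RHS]addrC.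
by congr (_ + _); exact: addrACA.
Qed.

(** The constant part of the associator is an identity, so the ε-parts of the arguments enter both
    sides alike and cancel. The converse evaluates at cells with zero ε-part. *)
Lemma assoc_eps_natural (a : associator D) :
  assoc_nat a <->
  (forall (X X' Y Y' Z Z' : C)
    (f f1 : hom1 X X') (g g1 : hom1 Y Y') (h h1 : hom1 Z Z')
    (τ : hom2 (eps D) f f1) (σ : hom2 (eps D) g g1) (ρ : hom2 (eps D) h h1),
    assoc_eps a f1 g1 h1 • thom2 (eps D) τ (thom2 (eps D) σ ρ) =
    thom2 (eps D) τ (thom2 (eps D) σ ρ) • assoc_eps a f g h).
Proof.
split=> H X X' Y Y' Z Z' f f1 g g1 h h1.
  move=> [τ τ1] [σ σ1] [ρ ρ1]; apply: eps_eq => /=.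
    by rewrite (vcomp_id2l G2) (vcomp_id2r G2).
  by rewrite (vcomp_id2l G2) (vcomp_id2r G2) H addrC.
move=> τ σ ρ.
have /(congr1 snd) /= := H _ _ _ _ _ _ _ _ _ _ _ _ (τ, 0) (σ, 0) (ρ, 0).
by rewrite !(thom20r, thom20l, addr0, vcomp0r, vcomp0l) add0r.
Qed.

Lemma psi_eps_natural (s : functor_hat D) :
  psi_nat s <->
  (forall (X X' Y Y' : C) (f f1 : hom1 X X') (g g1 : hom1 Y Y')
    (τ : hom2 (eps D) f f1) (σ : hom2 (eps D) g g1),
    psi_eps s f1 g1 • thom2 (eps D) τ σ = thom2 (eps D) τ σ • psi_eps s f g).
Proof.
split=> H X X' Y Y' f f1 g g1.
  move=> [τ τ1] [σ σ1]; apply: eps_eq => /=.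
    by rewrite (vcomp_id2l G2) (vcomp_id2r G2).
  by rewrite (vcomp_id2l G2) (vcomp_id2r G2) H addrC.
move=> τ σ.
have /(congr1 snd) /= := H _ _ _ _ _ _ _ _ (τ, 0) (σ, 0).
by rewrite !(thom20r, thom20l, addr0, vcomp0r, vcomp0l) add0r.
Qed.

Lemma natural_fam_assoc (a : associator D) : natural (fam_assoc a) <->
  assoc_nat a.
Proof.
split=> [H X X' Y Y' Z Z' f f1 g g1 h h1 τ σ ρ|H].
  exact: (H (X, (Y, Z)) (X', (Y', Z')) (@NCell _ _ 2 (X, (Y, Z)) (X', (Y', Z'))
    (f, (g, h)) (f1, (g1, h1)) (τ, (σ, ρ)))).
move=> [X [Y Z]] [X' [Y' Z']] [[f [g h]] [f1 [g1 h1]] [τ [σ ρ]]]; exact: H.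
Qed.

Lemma special_fam_assoc (a : associator D) : special (fam_assoc a) <->
  forall X Y Z : C, a _ _ _ _ _ _ (id1 X) (id1 Y) (id1 Z) = 0.
Proof.
split=> [H X Y Z|H].
  exact: (H (X, (Y, Z)) (X, (Y, Z)) (id1 X, (id1 Y, id1 Z)) (@IsIds _ 2 (X, (Y, Z)))).
by move=> X Z c /= []  [A [B E]]; exact: H.
Qed.

Lemma natural_fam_psi (s : functor_hat D) : natural (fam_psi s) <->
  psi_nat s.
Proof.
split=> [H X X' Y Y' f f1 g g1 τ σ|H].
  exact: (H (X, Y) (X', Y')
    (@NCell _ _ 1 (X, Y) (X', Y') (f, g) (f1, g1) (τ, σ))).
move=> [X Y] [X' Y'] [[f g] [f1 g1] [τ σ]]; exact: H.
Qed.

Lemma special_fam_psi (s : functor_hat D) : special (fam_psi s) <->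
  forall X Y : C, s _ _ _ _ (id1 X) (id1 Y) = 0.
Proof.
split=> [H X Y|H]; first exact: (H (X, Y) (X, Y) (id1 X, id1 Y) (@IsIds _ 1 (X, Y))).
by move=> X Z c /= [] [A B]; exact: H.
Qed.

(** For the cocycle identity of an interchanger, which relates composites bracketed differently:
    their ε-parts have to be compared across a cast. *)
Lemma heq2_eps (X Y X' Y' : C) (f g : hom1 X Y) (f' g' : hom1 X' Y')
    (ef : Arrow f' = Arrow f) (eg : Arrow g' = Arrow g)
    (τ : hom2 (eps D) f g) (σ : hom2 (eps D) f' g') :
  heq2 (τ.1 : hom2 D f g) (σ.1 : hom2 D f' g') ->
  (heq2 τ σ <-> τ.2 = cast2 ef eg (σ.2 : hom2 D f' g')).
Proof.
move=> /(heq2P ef eg) e0.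
have /= E := heq2P ef eg τ σ; rewrite E cast2_eps; split=> [->//|e1].
by apply: eps_eq.
Qed.

(** These axioms involve ⊗⁽¹⁾ alone. Invertibility is inherited from the constant part, the two unit
    axioms are the two positions of an identity in a chain of two, and the cocycle identity is δ_h
    evaluated on a chain of three. *)
Lemma interchanger_epsP (t : interchanger D) : is_interchanger (hat_eps t) <->
  [/\ natural (fam_hat t), special (fam_hat t) & delta_h (fam_hat t) = 0].
Proof.
have cocP (X X' X'' X''' Y Y' Y'' Y''' : C)
    (f'' : hom1 X'' X''') (g'' : hom1 Y'' Y''') (f' : hom1 X' X'') (g' : hom1 Y' Y'')
    (f : hom1 X X') (g : hom1 Y Y') :
  heq2 (hat_eps t f'' g'' (f' ∘₁ f) (g' ∘₁ g) •
      (id2 (eps D) (f'' ⊗₁ g'') ∘₂ hat_eps t f' g' f g))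
    (hat_eps t (f'' ∘₁ f') (g'' ∘₁ g') f g •
      (hat_eps t f'' g'' f' g' ∘₂ id2 (eps D) (f ⊗₁ g))) <->
  delta_h (fam_hat t)
    (@chain_cons _ C 1 1 (X, Y) (X'', Y'') (X''', Y''') (f'', g'')
      (@chain1 _ C 1 (X, Y) (X', Y') (X'', Y'') (f', g') (f, g))) = 0.
  rewrite delta_h_hat.
  rewrite (heq2_eps (Arrow_compA (f'' ⊗₁ g'') (f' ⊗₁ g') (f ⊗₁ g))
    (Arrow_tens T (Arrow_compA f'' f' f) (Arrow_compA g'' g' g))) /=; last first.
    exact: hat_cocycle.
  rewrite hcomp0l hcomp0r addr0 add0r cast2D.
  by apply: eq_subr0P; rewrite opprD addrA [LHS](ACl (1*3*4*2)).
split=> [[_ tN tc tl tr]|[/natural_fam_hat tN /special_fam_hat tS tc]].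
  split.
  - apply/natural_fam_hat=> X X' X'' Y Y' Y'' f' f1' g' g1' f f1 g g1 τ' σ' τ σ.
    have /(congr1 snd) /= := tN _ _ _ _ _ _ _ _ _ _ _ _ _ _
      (τ', 0) (σ', 0) (τ, 0) (σ, 0).
    by rewrite !(thom20r, thom20l, hcomp0r, hcomp0l, addr0, vcomp0r, vcomp0l) add0r.
  - apply/special_fam_hat=> X X' Y Y' f g; split.
      by have /is_id2_eps[] := tl _ _ _ _ f g.
    by have /is_id2_eps[] := tr _ _ _ _ f g.
  apply: functional_extensionality_dep => -[X Y].
  apply: functional_extensionality_dep => -[X''' Y'''].
  apply: functional_extensionality_dep => -[[X'' Y''] [[f'' g''] [[X' Y'] [[f' g'] [f g]]]]].
  exact/cocP/tc.
split.
- by move=> *; apply/invertible2_eps/(hat_invertible GH).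
- exact: hat_eps_natural.
- by move=> *; apply/cocP; rewrite tc.
- move=> X X' Y Y' f g; apply/is_id2_eps; split; first exact: hat_idl.
  by have [] := tS _ _ _ _ f g.
move=> X X' Y Y' f g; apply/is_id2_eps; split; first exact: hat_idr.
by have [] := tS _ _ _ _ f g.
Qed.

Lemma assoc_comp_epsP (t : interchanger D) (a : associator D)
    (X X' X'' Y Y' Y'' Z Z' Z'' : C)
    (f' : hom1 X' X'') (g' : hom1 Y' Y'') (h' : hom1 Z' Z'')
    (f : hom1 X X') (g : hom1 Y Y') (h : hom1 Z Z') :
  assoc_eps a (f' ∘₁ f) (g' ∘₁ g) (h' ∘₁ h) •
    cast2 (Arrow_comp (thomA T f' g' h') (thomA T f g h))
          (thomA T (f' ∘₁ f) (g' ∘₁ g) (h' ∘₁ h))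
      (thom2 (eps D) (hat_eps t f' g' f g) (id2 (eps D) (h' ∘₁ h)) •
       hat_eps t (f' ⊗₁ g') h' (f ⊗₁ g) h) =
  thom2 (eps D) (id2 (eps D) (f' ∘₁ f)) (hat_eps t g' h' g h) •
    hat_eps t f' (g' ⊗₁ h') f (g ⊗₁ h) •
    (assoc_eps a f' g' h' ∘₂ id2 (eps D) (f ⊗₁ g ⊗₁ h)) •
    (id2 (eps D) (f' ⊗₁ g' ⊗₁ h') ∘₂ assoc_eps a f g h) <->
  (delta_h (fam_assoc a) + delta_v (fam_hat t))
    (X, (Y, Z)) (X'', (Y'', Z''))
    (@chain1 _ C 2 (X, (Y, Z)) (X', (Y', Z')) (X'', (Y'', Z''))
      (f', (g', h')) (f, (g, h))) = 0.
Proof.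
(* The axiom contains the left-nested composite of interchangers, δ_h the right-nested Θ_3.
   Associativity of the undeformed interchanger identifies them, and it is also the constant part of
   the axiom. *)
have HA := cast2_heq (Arrow_comp (thomA T f' g' h') (thomA T f g h))
  (thomA T (f' ∘₁ f) (g' ∘₁ g) (h' ∘₁ h)) (hat_assoc G f' g' h' f g h).
rewrite cast2_eps; apply: iff_trans (eps_eqP _) _ => /=.
  by rewrite !(vcomp_id2l G2) !(hcomp_id2 G2) !(vcomp_id2r G2).
rewrite !(thom20l, thom20r, hcomp0l, hcomp0r, addr0, add0r).
rewrite !(hcomp_id2 G2, vcomp_id2l G2, vcomp_id2r G2).
apply: eq_subr0PC.
(* Families are added pointwise by conversion; the sum is restated so that the formulas for δ_h and
   δ_v can be rewritten. *)
transitivity (delta_h (fam_assoc a)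
    (@chain1 _ C 2 (X, (Y, Z)) (X', (Y', Z')) (X'', (Y'', Z''))
      (f', (g', h')) (f, (g, h))) + delta_v (fam_hat t)
    (@chain1 _ C 2 (X, (Y, Z)) (X', (Y', Z')) (X'', (Y'', Z''))
      (f', (g', h')) (f, (g, h)))); first by [].
rewrite delta_h_assoc delta_v_hat HA cast2D.
rewrite !vcompDr !(vcompA G2) !opprD !addrA.
by rewrite [LHS](ACl (1*3*6*4*5*7*2)).
Qed.

(** All constant parts are identities, so the ε-part equates a sum of three terms with a sum of
    four: five terms in [a] make up δ_v, two in [p] make up φ. *)
Lemma pent_epsP (a : associator D) (p : pentagonator D) (X X' Y Y' Z Z' W W' : C)
    (f : hom1 X X') (g : hom1 Y Y') (h : hom1 Z Z') (k : hom1 W W') :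
  assoc_eps a f g (h ⊗₁ k) •
    castE (thomA T f g (h ⊗₁ k)) (assoc_eps a (f ⊗₁ g) h k) •
    castE (Arrow_idr (f ⊗₁ g ⊗₁ h ⊗₁ k))
      (id2 (eps D) (f ⊗₁ g ⊗₁ h ⊗₁ k) ∘₂ pent_eps p X Y Z W) =
  castE (Arrow_idl (f ⊗₁ g ⊗₁ h ⊗₁ k))
      (pent_eps p X' Y' Z' W' ∘₂ id2 (eps D) (f ⊗₁ g ⊗₁ h ⊗₁ k)) •
    (thom2 (eps D) (id2 (eps D) f) (assoc_eps a g h k)) •
    castE (Arrow_tensr T f (thomA T g h k)) (assoc_eps a f (g ⊗₁ h) k) •
    castE (Arrow_tensA3 T f g h k)
      (thom2 (eps D) (assoc_eps a f g h) (id2 (eps D) k)) <->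
  (delta_v (fam_assoc a) + pent_phi (pent_of p))
    (X, (Y, (Z, W))) (X', (Y', (Z', W'))) (f, (g, (h, k))) = 0.
Proof.
rewrite /castE !cast2_eps; apply: iff_trans (eps_eqP _) _ => /=.
  rewrite !(thom2_id2 GT) !(hcomp_id2 G2) -![cast2 _ _ (id2 _ _)]/(castE _ _) !castE_id2.
  by rewrite !(vcomp_id2l G2).
rewrite !(thom20l, thom20r, hcomp0l, hcomp0r, addr0, add0r, hcomp_id2 G2, thom2_id2 GT).
rewrite -![cast2 _ _ (id2 _ _)]/(castE _ _) !castE_id2.
rewrite !(vcomp_id2l G2, vcomp_id2r G2).
apply: eq_subr0PC.
transitivity (delta_v (fam_assoc a)
  ((f, (g, (h, k))) : @homs C 3 (X, (Y, (Z, W))) (X', (Y', (Z', W')))) +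
  pent_phi (pent_of p) ((f, (g, (h, k))) : @homs C 3 (X, (Y, (Z, W))) (X', (Y', (Z', W'))))) => //.
rewrite delta_v_assoc pent_phiE !opprD !addrA.
by rewrite [LHS](ACl (5*3*1*6*7*2*4)).
Qed.

Lemma pent_cocycle_epsP (p : pentagonator D) (X Y Z W U : C) :
  castE (Arrow_id (tobA T X Y (Z ⊗₀ W ⊗₀ U))) (pent_eps p (X ⊗₀ Y) Z W U) •
    castE (Arrow_id (congr1 (fun V => X ⊗₀ Y ⊗₀ V) (tobA T Z W U)))
      (pent_eps p X Y (Z ⊗₀ W) U) •
    castE (Arrow_tens_id
             (etrans (tobA3 T X Y (Z ⊗₀ W) U)
                (congr1 (fun V => X ⊗₀ Y ⊗₀ V) (tobA T Z W U))))
      (thom2 (eps D) (pent_eps p X Y Z W) (id2 (eps D) (id1 U))) =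
  pent_eps p X Y Z (W ⊗₀ U) •
    castE (Arrow_id (congr1 (tob T X) (tobA T Y Z (W ⊗₀ U))))
      (pent_eps p X (Y ⊗₀ Z) W U) •
    castE (Arrow_tens_id erefl)
      (thom2 (eps D) (id2 (eps D) (id1 X)) (pent_eps p Y Z W U)) <->
  delta_pent (pent_of p) ((X, (Y, (Z, (W, U)))) : obs C 4) = 0.
Proof.
rewrite /castE !cast2_eps; apply: iff_trans (eps_eqP _) _ => /=.
  rewrite !(thom2_id2 GT) -![cast2 _ _ (id2 _ _)]/(castE _ _) !castE_id2.
  by rewrite !(vcomp_id2l G2).
rewrite !(thom20l, thom20r, addr0, add0r, thom2_id2 GT).
rewrite -![cast2 _ _ (id2 _ _)]/(castE _ _) !castE_id2.
rewrite !(vcomp_id2l G2, vcomp_id2r G2).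
apply: eq_subr0PC; rewrite delta_pentE !opprD !addrA.
by rewrite [LHS](ACl (1*3*5*6*4*2)).
Qed.

(** Solving the ε-part for ⊗⁽¹⁾ - ⊗'⁽¹⁾ leaves the three terms of δ_h, with the signs they have
    there. *)
Lemma hat_comp_epsP (t t' : interchanger D) (s : functor_hat D) (X X' X'' Y Y' Y'' : C)
    (f' : hom1 X' X'') (g' : hom1 Y' Y'') (f : hom1 X X') (g : hom1 Y Y') :
  psi_eps s (f' ∘₁ f) (g' ∘₁ g) • hat_eps t f' g' f g =
  hat_eps t' f' g' f g •
    (psi_eps s f' g' ∘₂ id2 (eps D) (f ⊗₁ g)) •
    (id2 (eps D) (f' ⊗₁ g') ∘₂ psi_eps s f g) <->
  t _ _ _ _ _ _ f' g' f g - t' _ _ _ _ _ _ f' g' f g =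
  hat_of (delta_h (fam_psi s)) f' g' f g.
Proof.
apply: iff_trans (eps_eqP _) _ => /=.
  by rewrite !(hcomp_id2 G2) (vcomp_id2l G2) !(vcomp_id2r G2).
rewrite !(hcomp0l, hcomp0r, addr0, add0r, hcomp_id2 G2, vcomp_id2l G2, vcomp_id2r G2).
rewrite delta_h_psi !vcompDr.
apply: eq_subrP; rewrite ?opprK !opprD ?opprK !addrA.
by rewrite [LHS](ACl (1*5*3*2*4)).
Qed.

Lemma assoc_psi_epsP (a a' : associator D) (s : functor_hat D) (w : functor_omega D)
    (X X' Y Y' Z Z' : C) (f : hom1 X X') (g : hom1 Y Y') (h : hom1 Z Z') :
  castE (Arrow_idl (f ⊗₁ g ⊗₁ h)) (omega_eps w X' Y' Z' ∘₂ id2 (eps D) (f ⊗₁ g ⊗₁ h)) •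
    (thom2 (eps D) (id2 (eps D) f) (psi_eps s g h)) • psi_eps s f (g ⊗₁ h) •
    assoc_eps a f g h =
  assoc_eps a' f g h •
    castE (thomA T f g h) (thom2 (eps D) (psi_eps s f g) (id2 (eps D) h)) •
    castE (thomA T f g h) (psi_eps s (f ⊗₁ g) h) •
    castE (Arrow_idr (f ⊗₁ g ⊗₁ h)) (id2 (eps D) (f ⊗₁ g ⊗₁ h) ∘₂ omega_eps w X Y Z) <->
  a _ _ _ _ _ _ f g h - a' _ _ _ _ _ _ f g h =
  - assoc_of (delta_v (fam_psi s) + pent_phi (pent_omega w)) f g h.
Proof.
rewrite /castE !cast2_eps; apply: iff_trans (eps_eqP _) _ => /=.
  rewrite !(thom2_id2 GT) !(hcomp_id2 G2) -![cast2 _ _ (id2 _ _)]/(castE _ _) !castE_id2.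
  by rewrite !(vcomp_id2l G2).
rewrite !(thom20l, thom20r, hcomp0l, hcomp0r, addr0, add0r, hcomp_id2 G2, thom2_id2 GT).
rewrite -![cast2 _ _ (id2 _ _)]/(castE _ _) !castE_id2.
rewrite !(vcomp_id2l G2, vcomp_id2r G2).
transitivity (a _ _ _ _ _ _ f g h - a' _ _ _ _ _ _ f g h =
  - (assoc_of (delta_v (fam_psi s)) f g h +
     pent_phi (pent_omega w) ((f, (g, h)) : @homs C 2 (X, (Y, Z)) (X', (Y', Z'))))) => //.
rewrite delta_v_psi pent_phi_omegaE.
apply: eq_subrP; rewrite ?opprK !opprD ?opprK !addrA.
by rewrite [LHS](ACl (1*8*3*6*2*7*4*5)).
Qed.

Lemma pent_omega_epsP (p p' : pentagonator D) (w : functor_omega D) (X Y Z W : C) :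
  castE (Arrow_id (tobA T X Y (Z ⊗₀ W))) (omega_eps w (X ⊗₀ Y) Z W) •
    omega_eps w X Y (Z ⊗₀ W) • pent_eps p X Y Z W =
  pent_eps p' X Y Z W •
    castE (Arrow_tens_id (tobA3 T X Y Z W))
      (thom2 (eps D) (omega_eps w X Y Z) (id2 (eps D) (id1 W))) •
    castE (Arrow_id (congr1 (tob T X) (tobA T Y Z W))) (omega_eps w X (Y ⊗₀ Z) W) •
    castE (Arrow_tens_id erefl)
      (thom2 (eps D) (id2 (eps D) (id1 X)) (omega_eps w Y Z W)) <->
  p X Y Z W - p' X Y Z W = pentagonator_of (delta_pent (pent_omega w)) X Y Z W.
Proof.
rewrite /castE !cast2_eps; apply: iff_trans (eps_eqP _) _ => /=.
  rewrite !(thom2_id2 GT) -![cast2 _ _ (id2 _ _)]/(castE _ _) !castE_id2.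
  by rewrite !(vcomp_id2l G2).
rewrite !(thom20l, thom20r, addr0, add0r, thom2_id2 GT).
rewrite -![cast2 _ _ (id2 _ _)]/(castE _ _) !castE_id2.
rewrite !(vcomp_id2l G2, vcomp_id2r G2) [pentagonator_of _ _ _ _ _]delta_pent_omegaE.
apply: eq_subrP; rewrite ?opprK !opprD ?opprK !addrA.
by rewrite [LHS](ACl (1*7*4*3*5*2*6)).
Qed.

End Translate.

(** * Cochains of total degree one and two *)

Section Assembly.
Context (K : comPzRingType) (C : gray_semigroup K).
Local Notation D := (gcells C).

Lemma fam_ext m n (φ φ' : fam C m n) :
  (forall X Z (c : chain m X Z), φ X Z c = φ' X Z c) -> φ = φ'.
Proof. by move=> e; do 3![apply: functional_extensionality_dep => ?]; exact: e. Qed.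

Lemma fam0_2_ext (φ φ' : fam C 0 2) :
  (forall X X' Y Y' Z Z' (f : hom1 X X') (g : hom1 Y Y') (h : hom1 Z Z'),
    assoc_of φ f g h = assoc_of φ' f g h) -> φ = φ'.
Proof.
move=> e; apply: fam_ext => -[X [Y Z]] [X' [Y' Z']] [f [g h]]; exact: e.
Qed.

Lemma fam1_1_ext (φ φ' : fam C 1 1) :
  (forall X X' X'' Y Y' Y'' (f' : hom1 X' X'') (g' : hom1 Y' Y'')
    (f : hom1 X X') (g : hom1 Y Y'),
    hat_of φ f' g' f g = hat_of φ' f' g' f g) -> φ = φ'.
Proof.
move=> e; apply: fam_ext => -[X Y] [X'' Y''] [[X' Y'] [[f' g'] [f g]]]; exact: e.
Qed.

Lemma pent3_ext (p p' : pent C 3) :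
  (forall X Y Z W, pentagonator_of p X Y Z W = pentagonator_of p' X Y Z W) -> p = p'.
Proof.
by move=> e; apply: functional_extensionality_dep => -[X [Y [Z W]]]; exact: e.
Qed.

(** Total degree 1 consists of X^{0,1} only, and degree 2 of X^{1,1} and X^{0,2}; the second index
    is stored shifted by one. In the other branches the equation on the indices is false, and 0 is a
    default value. *)
Definition unit1 (y : xmod C 0 1) : xunit C 1 := fun m =>
  match m return forall n, (m + n.+1)%N = 1%N -> xmod C m n.+1 with
  | 0 => fun n => match n return (0 + n.+1)%N = 1%N -> xmod C 0 n.+1 with
                  | 0 => fun=> y
                  | _ => fun=> 0
                  end
  | _ => fun _ _ => 0
  end.

Definition unit2 (x : xmod C 1 1) (y : xmod C 0 2) : xunit C 2 := fun m =>
  match m return forall n, (m + n.+1)%N = 2%N -> xmod C m n.+1 with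
  | 0 => fun n => match n return (0 + n.+1)%N = 2%N -> xmod C 0 n.+1 with
                  | 1 => fun=> y
                  | _ => fun=> 0
                  end
  | 1 => fun n => match n return (1 + n.+1)%N = 2%N -> xmod C 1 n.+1 with
                  | 0 => fun=> x
                  | _ => fun=> 0
                  end
  | _ => fun _ _ => 0
  end.

Lemma unit2_eq (x x' : xmod C 1 1) (y y' : xmod C 0 2) :
  x = x' -> y.1 = y'.1 -> y.2 = y'.2 -> unit2 x y = unit2 x' y'.
Proof. by case: y y' => [φ p] [φ' p'] /= -> -> ->. Qed.

Lemma xunit_ext q (x y : xunit C q) : (forall m n e, x m n e = y m n e) -> x = y.
Proof. by move=> e; do 3![apply: functional_extensionality_dep => ?]; exact: e. Qed.

Lemma unit1E (z : xunit C 1) : z = unit1 (z 0%N 0%N erefl).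
Proof.
apply: xunit_ext => -[|m] [|n] e; try by exfalso; move: e; rewrite ?addSn ?addnS.
by rewrite (Prop_irrelevance e erefl).
Qed.

(** The equation [e] is absurd at all but two pairs of indices, where it is [erefl] by proof
    irrelevance. *)
Lemma unit2E (z : xunit C 2) : z = unit2 (z 1%N 0%N erefl) (z 0%N 1%N erefl).
Proof.
apply: xunit_ext => -[|[|m]] [|[|n]] e;
  try by exfalso; move: e; rewrite ?addSn ?addnS.
  by rewrite (Prop_irrelevance e erefl).
by rewrite (Prop_irrelevance e erefl).
Qed.

Lemma in_xunit1 (y : xmod C 0 1) : in_xunit (unit1 y) <-> natural y.1 /\ special y.1.
Proof.
split=> [/(_ 0%N 0%N erefl)//|H] [|m] [|n] e;
  by [|exfalso; move: e; rewrite ?addSn ?addnS].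
Qed.

Lemma in_xunit2 (x : xmod C 1 1) (y : xmod C 0 2) : in_xunit (unit2 x y) <->
  (natural x /\ special x) /\ (natural y.1 /\ special y.1).
Proof.
split=> [H|[H H']].
  by split; [exact: (H 1%N 0%N erefl) | exact: (H 0%N 1%N erefl)].
by move=> [|[|m]] [|[|n]] e; by [|exfalso; move: e; rewrite ?addSn ?addnS].
Qed.

Lemma delta_unit1 (φ : fam C 0 1) (p : pent C 2) :
  delta_unit (unit1 (φ, p)) =
  unit2 (- delta_h φ) (delta_v φ + pent_phi p, - delta_pent p).
Proof.
apply: xunit_ext => -[|[|m]] [|[|n]] e;
  try by exfalso; move: e; rewrite ?addSn ?addnS.
  by rewrite /delta_unit /= add0r.
by rewrite /delta_unit /= expr1 scaleN1r addr0.
Qed.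

Lemma delta_unit2 (x : fam C 1 1) (φ : fam C 0 2) (p : pent C 3) :
  delta_unit (unit2 x (φ, p)) = 0 <->
  [/\ delta_h x = 0, delta_h φ + delta_v x = 0,
      delta_v φ + pent_phi p = 0 & delta_pent p = 0].
Proof.
split=> [e|[e1 e2 e3 e4]].
  have ex m n (i : (m + n.+1)%N = 3%N) :
      (delta_unit (unit2 x (φ, p)) : forall m n, (m + n.+1)%N = 3%N -> xmod C m n.+1)
        m n i = 0 by rewrite e.
  have := ex 2%N 0%N erefl; rewrite /delta_unit /= expr1 scaleN1r addr0 => e1.
  (* In X^{1,2} the horizontal sign is (-1)^2, so both differentials occur with a plus; in X^{2,1}
     above it was -1. *)
  have := ex 1%N 1%N erefl; rewrite /delta_unit /= sqrrN expr1n scale1r => e2.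
  have := ex 0%N 2%N erefl; rewrite /delta_unit /= add0r => e3.
  split=> //; first by apply: oppr_inj; rewrite e1 oppr0.
    exact: (congr1 fst e3).
  by apply: oppr_inj; rewrite oppr0; exact: (congr1 snd e3).
apply: xunit_ext => -[|[|[|m]]] [|[|[|n]]] e;
  try by exfalso; move: e; rewrite ?addSn ?addnS.
- by rewrite /delta_unit /= add0r e3 e4 oppr0.
- by rewrite /delta_unit /= sqrrN expr1n scale1r e2.
by rewrite /delta_unit /= expr1 scaleN1r e1 oppr0 addr0.
Qed.

Lemma semigroupal_epsP (t : interchanger D) (a : associator D) (p : pentagonator D) :
  is_semigroupal (hat_eps t) (assoc_eps a) (pent_eps p) <->
  in_xunit (unit2 (fam_hat t) (fam_assoc a, pent_of p)) /\
  delta_unit (unit2 (fam_hat t) (fam_assoc a, pent_of p)) = 0.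
Proof.
split=> [[/interchanger_epsP[tN tS tc] _ _ aN ai ac ap pc]|].
  split.
    apply/in_xunit2; split; split=> //=.
      exact/natural_fam_assoc/assoc_eps_natural.
    by apply/special_fam_assoc=> X Y Z; exact/is_id2_id2/ai.
  apply/delta_unit2; split=> //.
  - apply: fam_ext => -[X [Y Z]] [X'' [Y'' Z'']] [[X' [Y' Z']] [[f' [g' h']] [f [g h]]]].
    exact/assoc_comp_epsP/ac.
  - apply: fam_ext => -[X [Y [Z W]]] [X' [Y' [Z' W']]] [f [g [h k]]].
    exact/pent_epsP/ap.
  apply: functional_extensionality_dep => -[X [Y [Z [W U]]]].
  exact/pent_cocycle_epsP/pc.
case=> /in_xunit2[[tN tS] [aN aS]] /delta_unit2[tc ac ap pc]; split.
- exact/interchanger_epsP.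
(* The constant part is an identity, which already makes the cell invertible. *)
- by move=> *; apply/invertible2_eps/invertible2_id2.
- by move=> *; apply/invertible2_eps/invertible2_id2.
- exact/assoc_eps_natural/natural_fam_assoc.
- by move=> X Y Z; apply/is_id2_id2; exact: (special_fam_assoc a).1.
- by move=> *; apply/assoc_comp_epsP; rewrite ac.
- by move=> *; apply/pent_epsP; rewrite ap.
by move=> *; apply/pent_cocycle_epsP; rewrite pc.
Qed.

Lemma semigroupal_id_epsP (t t' : interchanger D) (a a' : associator D)
    (p p' : pentagonator D) (s : functor_hat D) (w : functor_omega D) :
  is_semigroupal_id (hat_eps t) (assoc_eps a) (pent_eps p)
    (hat_eps t') (assoc_eps a') (pent_eps p') (psi_eps s) (omega_eps w) <->
  [/\ natural (fam_psi s), special (fam_psi s),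
      fam_hat t - fam_hat t' = delta_h (fam_psi s),
      fam_assoc a - fam_assoc a' = - (delta_v (fam_psi s) + pent_phi (pent_omega w)) &
      pent_of p - pent_of p' = delta_pent (pent_omega w)].
Proof.
split=> [[_ _ sN si sc sa sp]|[sN sS sc sa sp]].
  split.
  - exact/natural_fam_psi/psi_eps_natural.
  - by apply/special_fam_psi=> X Y; exact/is_id2_id2/si.
  - apply: fam1_1_ext => X X' X'' Y Y' Y'' f' g' f g.
    exact/(hat_comp_epsP t t')/sc.
  - apply: fam0_2_ext => X X' Y Y' Z Z' f g h.
    exact/(assoc_psi_epsP a a')/sa.
  apply: pent3_ext => X Y Z W; exact/(pent_omega_epsP p p')/sp.
split.
- by move=> *; apply/invertible2_eps/invertible2_id2.
- by move=> *; apply/invertible2_eps/invertible2_id2.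
- exact/psi_eps_natural/natural_fam_psi.
- by move=> X Y; apply/is_id2_id2; exact: (special_fam_psi s).1.
- by move=> *; apply/hat_comp_epsP; rewrite -sc.
- by move=> *; apply/assoc_psi_epsP; rewrite -[RHS]/(assoc_of (- _) _ _ _) -sa.
by move=> *; apply/pent_omega_epsP; rewrite -sp.
Qed.

(** * Compatibility with negation *)

Lemma fam_oppE m n (φ : fam C m n) X Z c : (- φ) X Z c = - φ X Z c.
Proof. by []. Qed.

Lemma naturalN m n (φ : fam C m n) : natural φ -> natural (- φ).
Proof.
move=> φN X Z r; rewrite !fam_oppE.
rewrite vcompNl vcompNr.
by rewrite φN.
Qed.

Lemma specialN m n (φ : fam C m n) : special φ -> special (- φ).
Proof. by move=> φS X Z c /φS; rewrite fam_oppE => ->; rewrite oppr0. Qed.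

(** Each summand is linear in φ. With the analogous lemmas for δ_v, φ and δ_pent this gives the
    coboundary of (-ψ, -ω). *)
Lemma delta_hN m n (φ : fam C m n) : delta_h (- φ) = - delta_h φ.
Proof.
apply: fam_ext => X Z c; rewrite fam_oppE /delta_h !opprD; congr (_ + _ + _).
- rewrite fam_oppE hcompNr.
  by rewrite vcompNr.
- rewrite -sumrN; apply: eq_bigr => i _; rewrite fam_oppE -scalerN.
  by rewrite vcompNl cast2N.
rewrite fam_oppE hcompNl -scalerN.
by rewrite vcompNr cast2N.
Qed.

Lemma delta_vN m n (φ : fam C m n) : delta_v (- φ) = - delta_v φ.
Proof.
apply: fam_ext => X Z c; rewrite fam_oppE /delta_v !opprD; congr (_ + _ + _).
- rewrite fam_oppE thom2Nr.
  by rewrite vcompNl cast2N.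
- rewrite -sumrN; apply: eq_bigr => i _; rewrite fam_oppE -scalerN.
  by rewrite vcompNr cast2N.
rewrite fam_oppE thom2Nl -scalerN.
by rewrite vcompNl cast2N.
Qed.

Lemma pent_oppE n (p : pent C n) X : (- p) X = - p X.
Proof. by []. Qed.

Lemma pent_phiN n (p : pent C n) : pent_phi (- p) = - pent_phi p.
Proof.
apply: fam_ext => X Z f; rewrite fam_oppE /pent_phi !pent_oppE opprD.
rewrite hcompNl hcompNr.
by rewrite /castE !cast2N.
Qed.

Lemma delta_pentN n (p : pent C n) : delta_pent (- p) = - delta_pent p.
Proof.
apply: functional_extensionality_dep => X.
rewrite pent_oppE /delta_pent /castE !opprD; congr (_ + _ + _).
- rewrite pent_oppE thom2Nr.
  by rewrite cast2N.
- rewrite -sumrN; apply: eq_bigr => i _; rewrite pent_oppE -scalerN.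
  by rewrite cast2N.
rewrite pent_oppE thom2Nl -scalerN.
by rewrite cast2N.
Qed.

(** * Deformations as cocycles, equivalences as coboundaries *)

Definition deformation_cocycle (d : deformation C) : unit_cocycle C 2 :=
  let h := (semigroupal_epsP _ _ _).1 (defP d) in UnitCocycle h.1 h.2.

Lemma cocycle_semigroupal (z : unit_cocycle C 2) :
  is_semigroupal (hat_eps (hat_of (@ucocycle K C 2 z 1%N 0%N erefl)))
    (assoc_eps (assoc_of (@ucocycle K C 2 z 0%N 1%N erefl).1))
    (pent_eps (pentagonator_of (@ucocycle K C 2 z 0%N 1%N erefl).2)).
Proof.
apply/semigroupal_epsP.
have -> : unit2 (fam_hat (hat_of (@ucocycle K C 2 z 1%N 0%N erefl)))
    (fam_assoc (assoc_of (@ucocycle K C 2 z 0%N 1%N erefl).1),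
     pent_of (pentagonator_of (@ucocycle K C 2 z 0%N 1%N erefl).2)) = ucocycle z.
  rewrite [RHS]unit2E; apply: unit2_eq.
  - exact: fam1_1_ext.
  - exact: fam0_2_ext.
  exact: pent3_ext.
by split; [exact: ucocycle_in | exact: ucocycleP].
Qed.

Definition cocycle_deformation (z : unit_cocycle C 2) : deformation C :=
  Deformation (cocycle_semigroupal z).

(** The data come back by conversion; only the proofs of the axioms have to be identified. *)
Lemma deformation_cocycleK : cancel deformation_cocycle cocycle_deformation.
Proof.
case=> t a p dP; rewrite /cocycle_deformation.
by move: (cocycle_semigroupal _) => dP'; congr Deformation; exact: Prop_irrelevance.
Qed.

Lemma unit_cocycle_inj q (z z' : unit_cocycle C q) : ucocycle z = ucocycle z' -> z = z'.
Proof.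
case: z z' => [x xin xP] [x' xin' xP'] /= e; subst x'.
by rewrite (Prop_irrelevance xin xin') (Prop_irrelevance xP xP').
Qed.

Lemma cocycle_deformationK : cancel cocycle_deformation deformation_cocycle.
Proof.
move=> z; apply: unit_cocycle_inj => /=.
rewrite [RHS]unit2E; apply: unit2_eq.
- exact: fam1_1_ext.
- exact: fam0_2_ext.
exact: pent3_ext.
Qed.

(** In degree 1 the total differential has components -δ_h, δ_v + φ and -δ_pent, while the
    equivalence equations give δ_h, -(δ_v + φ) and δ_pent: the opposite sign throughout, hence the
    negated cochain. *)
Lemma unit2_sub_delta (x x' : fam C 1 1) (φ φ' : fam C 0 2) (p p' : pent C 3)
    (ψ : fam C 0 1) (w : pent C 2) :
  unit2 x (φ, p) - unit2 x' (φ', p') = delta_unit (unit1 (- ψ, - w)) <->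
  [/\ x - x' = delta_h ψ, φ - φ' = - (delta_v ψ + pent_phi w) &
      p - p' = delta_pent w].
Proof.
rewrite delta_unit1 delta_hN delta_vN pent_phiN delta_pentN !opprK -opprD.
split=> [e|[e1 e2 e3]].
  have ex m n (i : (m + n.+1)%N = 2%N) :
      ((unit2 x (φ, p) - unit2 x' (φ', p')) : forall m n, (m + n.+1)%N = 2%N -> xmod C m n.+1)
        m n i = unit2 (delta_h ψ) (- (delta_v ψ + pent_phi w), delta_pent w) i
    by rewrite e.
  split; first exact: (ex 1%N 0%N erefl).
    exact: (congr1 fst (ex 0%N 1%N erefl)).
  exact: (congr1 snd (ex 0%N 1%N erefl)).
rewrite [LHS]unit2E -e1 -e2 -e3.
by congr (unit2 _ _).
Qed.

Lemma def_equivP (d d' : deformation C) :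
  def_equiv d d' <-> cohomologous (deformation_cocycle d) (deformation_cocycle d').
Proof.
split=> [[s [w /semigroupal_id_epsP[sN sS e1 e2 e3]]]|[y yin e]].
  exists (unit1 (- fam_psi s, - pent_omega w)); last exact/unit2_sub_delta.
  by apply/in_xunit1; split; [exact: naturalN | exact: specialN].
(* A coboundary of (φ, p) yields the equivalence with ψ = -φ and ω = -p; the double negation puts
   [y] into the form required by [unit2_sub_delta]. *)
pose φ := (y 0%N 0%N erefl).1; pose p := (y 0%N 0%N erefl).2.
have yE : y = unit1 (- - φ, - - p) by rewrite !opprK -surjective_pairing -unit1E.
have [yN yS] := yin 0%N 0%N erefl.
have sE : fam_psi (psi_of (- φ)) = - φ.
  by apply: fam_ext => -[X Y] [X' Y'] [f g].
have wE : pent_omega (omega_of (- p)) = - p.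
  by apply: functional_extensionality_dep => -[X [Y Z]].
exists (psi_of (- φ)), (omega_of (- p)); apply/semigroupal_id_epsP; rewrite sE wE.
move: e; rewrite yE => /unit2_sub_delta[e1 e2 e3].
by split=> //; [exact: naturalN | exact: specialN].
Qed.

End Assembly.

Unset Implicit Arguments.

Theorem theorem9p4 (K : comPzRingType) (C : gray_semigroup K) :
  exists F : deformation_classes C -> H_unit C 2, bijective F.
Proof.
exact: (quotient_set_bij (@deformation_cocycleK K C) (@cocycle_deformationK K C)
  (@def_equivP K C)).
Qed.
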